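(* Let $B\ge0$, $T>0$ and let $S\subset\mathbb{R}^2$ be measurable. If there is a constant $C_{\mathrm{obs}}>0$ such that the observability estimate $$\lVert e^{-H_BT}u_0\rVert_{L^2(\mathbb{R}^2)}^2\le C_{\mathrm{obs}}^2\int_0^T\lVert e^{-H_Bt}u_0\rVert_{L^2(S)}^2\,\mathrm{d}t\quad\text{for all }u_0\in L^2(\mathbb{R}^2)$$ holds, then $S$ is thick.
   Context: The Landau operator at field strength $B$ is $H_B=\tilde\partial_1^2+\tilde\partial_2^2$ with $\tilde\partial_1=i\partial_1-\frac B2x_2$, $\tilde\partial_2=i\partial_2+\frac B2x_1$, a self-adjoint operator in $L^2(\mathbb{R}^2)$ with operator core $C_0^\infty(\mathbb{R}^2)$; for $B=0$ it is $-\Delta$. A measurable set $S\subseteq\mathbb{R}^2$ is thick if there are $\ell=(\ell_1,\ell_2)\in(0,\infty)^2$ and $\rho\in(0,1]$ such that $\operatorname{Vol}(S\cap Q)\ge\rho\operatorname{Vol}(Q)$ for every rectangle $Q$ with side lengths $(\ell_1,\ell_2)$ parallel to the coordinate axes ($\operatorname{Vol}$ is Lebesgue measure). *)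

(* Defs.v *)
From HB Require Import structures.
From mathcomp Require Import all_boot all_order all_algebra.
From mathcomp Require Import all_classical all_reals all_analysis.
From mathcomp Require Import complex.

Set Implicit Arguments.
Unset Strict Implicit.
Unset Printing Implicit Defensive.
Import Order.TTheory GRing.Theory Num.Theory.
Import numFieldNormedType.Exports.

Local Open Scope classical_set_scope.
Local Open Scope ring_scope.

(* The carrier R * R with the sigma-algebra of Lebesgue measurable sets: it is
   strictly larger than the Borel one carried by the product type R * R. *)
Definition lebplane (R : realType) : measurableType _ :=
  caratheodory_type
    ((@lebesgue_measure R \x @lebesgue_measure R)%E^*)%mu.

Definition vol (R : realType) : {measure set (lebplane R) -> \bar R} :=
  @completed_measure_extension _ _ R
    (@lebesgue_measure R \x @lebesgue_measure R)%E.

Definition lebesgue_measurable (R : realType) (S : set (R * R)) : Prop :=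
  measurable (S : set (lebplane R)).

Definition thick (R : realType) (S : set (R * R)) : Prop :=
  exists l1 l2 rho : R, [/\ 0 < l1, 0 < l2, 0 < rho <= 1 &
    forall a b : R,
      let Q := `[a, a + l1] `*` `[b, b + l2] in
      (rho%:E * vol R Q <= vol R (S `&` Q))%E].

(* Elements of L^2(R^2) = L^2(R^2; C) are handled through representatives,
   up to equality almost everywhere. *)

Definition sqnorm (R : realType) (S : set (R * R)) (u : R * R -> R[i]) :
    \bar R :=
  (\int[vol R]_(x in S) (complex.Re (u x) ^+ 2 + complex.Im (u x) ^+ 2)%:E)%E.

Definition sqintegrable (R : realType) (u : R * R -> R[i]) : Prop :=
  [/\ measurable_fun setT (fun x : lebplane R => complex.Re (u x)),
      measurable_fun setT (fun x : lebplane R => complex.Im (u x)) &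
      (sqnorm setT u < +oo)%E].

Definition ae_equal (R : realType) (u v : R * R -> R[i]) : Prop :=
  {ae vol R, forall x, u x = v x}.

Definition e1 (R : realType) : R * R := (1, 0).
Definition e2 (R : realType) : R * R := (0, 1).

Fixpoint of_class_C (R : realType) (n : nat) (f : R * R -> R) : Prop :=
  if n is m.+1 then
    [/\ continuous f,
        forall x, derivable f x (e1 R) /\ derivable f x (e2 R),
        of_class_C m ('D_(e1 R) f) &
        of_class_C m ('D_(e2 R) f)]
  else continuous f.

Definition test_function (R : realType) (u : R * R -> R[i]) : Prop :=
  [/\ forall n, of_class_C n (fun x => complex.Re (u x)),
      forall n, of_class_C n (fun x => complex.Im (u x)) &
      compact (closure [set x | u x != 0])].

Definition partial (R : realType) (e : R * R) (u : R * R -> R[i]) :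
    R * R -> R[i] :=
  fun x => Complex ('D_e (fun y => complex.Re (u y)) x)
                   ('D_e (fun y => complex.Im (u y)) x).

Definition magnetic1 (R : realType) (B : R) (u : R * R -> R[i]) :
    R * R -> R[i] :=
  fun x => 'i%C * partial (e1 R) u x - (B / 2 * x.2)%:C%C * u x.

Definition magnetic2 (R : realType) (B : R) (u : R * R -> R[i]) :
    R * R -> R[i] :=
  fun x => 'i%C * partial (e2 R) u x + (B / 2 * x.1)%:C%C * u x.

Definition landau_expr (R : realType) (B : R) (u : R * R -> R[i]) :
    R * R -> R[i] :=
  fun x => magnetic1 B (magnetic1 B u) x + magnetic2 B (magnetic2 B u) x.

(* Unbounded operators are given by their graphs: [landau_op B u f] reads
   "u is in the domain of H_B and H_B u = f".  As C_c^oo is an operator core,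
   H_B is the closure in L^2 of the differential expression on C_c^oo. *)
Definition landau_op (R : realType) (B : R) (u f : R * R -> R[i]) : Prop :=
  [/\ sqintegrable u, sqintegrable f &
    exists phi : nat -> R * R -> R[i],
      [/\ forall n, test_function (phi n),
          sqnorm setT (fun x => phi n x - u x) @[n --> \oo] --> 0%E &
          sqnorm setT (fun x => landau_expr B (phi n) x - f x) @[n --> \oo]
            --> 0%E]].

(* [U t] represents e^(- t H) on L^2(R^2): [U] is a strongly continuous
   semigroup of bounded linear operators whose generator, domain included, is
   - H.  Linearity and boundedness make [U t] compatible with equality almost
   everywhere.  The values [U t u] for t < 0 or u outside L^2 are irrelevant. *)
Definition exp_semigroup (R : realType)
    (H : (R * R -> R[i]) -> (R * R -> R[i]) -> Prop)
    (U : R -> (R * R -> R[i]) -> (R * R -> R[i])) : Prop :=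
  [/\ (forall (t : R) u, 0 <= t -> sqintegrable u -> sqintegrable (U t u)),
      (forall (t : R) (a : R[i]) u v, 0 <= t -> sqintegrable u -> sqintegrable v ->
        ae_equal (U t (fun x => a * u x + v x))
                 (fun x => a * U t u x + U t v x)) &
      (forall t : R, 0 <= t -> exists M : R, forall u, sqintegrable u ->
        (sqnorm setT (U t u) <= M%:E * sqnorm setT u)%E)] /\
  [/\ (forall u, sqintegrable u -> ae_equal (U 0 u) u),
      (forall (s t : R) u, 0 <= s -> 0 <= t -> sqintegrable u ->
        ae_equal (U (s + t) u) (U s (U t u))),
      (forall (s : R) u, 0 <= s -> sqintegrable u ->
        sqnorm setT (fun x => U t u x - U s u x)
          @[t --> within [set t | 0 <= t] (nbhs s)] --> 0%E) &
      (forall u f, H u f <->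
        [/\ sqintegrable u, sqintegrable f &
          sqnorm setT (fun x => h^-1%:C%C * (u x - U h u x) - f x)
            @[h --> 0^'+] --> 0%E])].

(* Main.v *)
(* Test the estimate on u(x) = chi(|x - a|^2 / L^2) exp(-B |x - a|^2 / 4) times the
   phase of the magnetic translation by a, with chi a smooth bump.  Since H_B - B
   annihilates the product of the last two factors, (H_B - B) u has L^2 norm
   O(1 / L), uniformly in a, whereas the norm of u is bounded below.  As H_B >= 0,
   the energy estimate for y(t) = e^(-t H_B) u - e^(-B t) u, which solves
   y' = - H_B y - e^(-B t) (H_B - B) u, keeps y of size O(1 / L) on [0, T].  For L
   large the observability estimate thus bounds from below the norm of u on S, and
   |u| <= 1 is supported in the square of side 2 L around a: the volume of S in
   that square is bounded below. *)
Require Import Defs.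
From HB Require Import structures.
From mathcomp Require Import all_boot all_order all_algebra.
From mathcomp Require Import all_classical all_reals all_analysis.
From mathcomp Require Import complex.
From mathcomp Require Import measurable_realfun ring lra.
Import Order.TTheory GRing.Theory Num.Theory.
Import numFieldNormedType.Exports.
Local Open Scope classical_set_scope.
Local Open Scope ring_scope.

(* [lebesgue_measure] is a measure on [measurableTypeR R], which does not unify
   with the measurable structure inferred for [R]. *)
Notation borelplane R := (measurableTypeR R * measurableTypeR R)%type.

(** The operator is known only as the L^2 closure of a graph, and the semigroup only through
    one-sided difference quotients and strong continuity. This shapes the energy estimate.
    Positivity of H_B is put in the form |v - h H v|^2 <= |v|^2 + h^2 |H v|^2: it passes from test
    functions to the closure, and it is what one explicit Euler step of the equation for y consumes.
    Instead of differentiating |y|^2, its increment over a short step to the right is bounded, and a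
    Gronwall argument joins these steps using continuity from the left. Young's inequality with a
    free weight plays the part of the triangle inequality; the weight h in an Euler step costs a
    factor 1 + h, which is why the bound grows like exp t - 1, harmless on a bounded time interval.
    For B = 0 the Gaussian degenerates to the constant 1 and the eigenvalue to 0, so the same
    formulas cover the heat equation. *)

(** * Measure and integration on the plane *)

(** The product sigma-algebra is generated by rectangles. An open set belongs to it as the union of
    the rational boxes that it contains, of which there are countably many. *)
Lemma continuous_measurable_plane {R : realType} (F : R * R -> R) :
  continuous F -> measurable_fun setT (F : borelplane R -> R).
Proof.
move=> /continuousP cF; apply: (measurability _ (measurable_realfun.RGenOpens.measurableE R)).
move=> _ [_ [a [b ->] <-]]; rewrite setTI.
have := cF _ (@interval_open _ (BRight a) (BLeft b) isT isT).
move: (F @^-1` _) => O oO {F cF a b}.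
pose Q (i : (rat * rat) * (rat * rat)) : set (R * R) :=
  `]ratr i.1.1, ratr i.1.2[ `*` `]ratr i.2.1, ratr i.2.2[.
rewrite (_ : O = \bigcup_i (if `[< Q i `<=` O >] then Q i else set0)).
  apply: countable_bigcupT_measurable; first exact: countableP.
  by move=> i; case: ifP => // _; apply: measurableX; exact: measurable_itv.
apply/seteqP; split => [x Ox|x [i _]]; last by case: asboolP => // + Qx; exact.
have /nbhs_ballP[e /= e0 xeO] : nbhs x O by exact: open_nbhs_nbhs.
have rats (t : R) : exists p : rat * rat,
    [/\ t - e < ratr p.1, ratr p.1 < t, t < ratr p.2 & ratr p.2 < t + e].
  have /rat_in_itvoo[p] : t - e < t by rewrite ltrBlDr ltrDl.
  rewrite in_itv/= => /andP[? ?].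
  have /rat_in_itvoo[q] : t < t + e by rewrite ltrDl.
  by rewrite in_itv/= => /andP[? ?]; exists (p, q).
have [p [p1 p2 p3 p4]] := rats x.1; have [q [q1 q2 q3 q4]] := rats x.2.
exists (p, q) => //; case: asboolP; first by rewrite /Q /= !in_itv/= p2 p3 q2 q3.
case=> y [/=]; rewrite !in_itv/= => /andP[? ?] /andP[? ?].
by apply: xeO; split => /=; rewrite /ball/= ltr_distlC; apply/andP; split; lra.
Qed.

Lemma measurable_lebplane {R : realType} (A : set (borelplane R)) :
  measurable A -> lebesgue_measurable A.
Proof. by move=> mA; exact: caratheodory_measurable_mu_ext. Qed.

Lemma measurable_fun_lebplane {R : realType} d (V : measurableType d)
    (f : borelplane R -> V) :
  measurable_fun setT f -> measurable_fun setT (f : lebplane R -> V).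
Proof.
move=> mf _ Y mY; rewrite setTI.
by have := mf measurableT Y mY; rewrite setTI; exact: measurable_lebplane.
Qed.

Lemma vol_borel {R : realType} (A : set (borelplane R)) :
  measurable A -> vol R A = (lebesgue_measure \x lebesgue_measure)%E A.
Proof. by move=> mA; exact: measurable_mu_extE. Qed.

Lemma vol_rectangle {R : realType} (a b l1 l2 : R) : 0 <= l1 -> 0 <= l2 ->
  vol R (`[a, a + l1] `*` `[b, b + l2]) = (l1 * l2)%:E.
Proof.
have itv (c l : R) : 0 <= l -> lebesgue_measure `[c, c + l]%classic = l%:E.
  rewrite le_eqVlt lebesgue_measure_itv/= lte_fin => /predU1P[<-|l0].
    by rewrite addr0 ltxx.
  by rewrite ltrDl l0 -EFinD addrAC subrr add0r.
move=> l10 l20; rewrite vol_borel; last by apply: measurableX; exact: measurable_itv.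
rewrite product_measure1E; [|exact: measurable_itv|exact: measurable_itv].
by rewrite /= !itv// EFinM.
Qed.

(** Fubini is applied to the product measure, whereas norms are integrals for its completion. The
    identity from [lebplane] to the Borel plane is measurable and pushes [vol] forward to the
    product measure, so a change of variables identifies the two integrals of a Borel integrand. *)
Lemma integral_vol {R : realType} (f : borelplane R -> \bar R) :
  measurable_fun setT f -> (vol R).-integrable setT f ->
  (lebesgue_measure \x lebesgue_measure)%E.-integrable setT f /\
  (\int[vol R]_x f x =
   \int[(lebesgue_measure \x lebesgue_measure)%E]_x f x)%E.
Proof.
move=> mf intf.
have mid : measurable_fun setT (id : lebplane R -> borelplane R).
  by apply: measurable_fun_lebplane; exact: measurable_id.
have E (A : set (borelplane R)) : measurable A -> A `<=` setT ->
    (lebesgue_measure \x lebesgue_measure)%E A = pushforward (vol R) id A.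
  by move=> mA _; rewrite -vol_borel.
split; last first.
  rewrite (eq_measure_integral (pushforward (vol R) (id : lebplane R -> borelplane R)) E).
  by rewrite (integral_pushforward mid mf).
have [_ intf'] := integrableP _ _ _ (integrable_pushforward mid mf intf measurableT).
apply/integrableP; split=> //.
by rewrite (eq_measure_integral (pushforward (vol R) (id : lebplane R -> borelplane R)) E).
Qed.

Lemma continuous_integrable_vol {R : realType} (K : set (R * R))
    (F : R * R -> R) :
  compact K -> continuous F -> (forall x, ~ K x -> F x = 0) ->
  (vol R).-integrable setT (EFin \o F).
Proof.
move=> cK cF FK.
have [M [_ KM]] := compact_bounded cK.
have {KM} KM x : K x -> `|x| <= `|M| + 1.
  by move=> Kx; apply: (KM (`|M| + 1)) => //; rewrite (le_lt_trans (ler_norm M))// ltrDl.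
pose N := `|M| + 1; pose D : set (R * R) := `[- N, - N + 2 * N] `*` `[- N, - N + 2 * N].
have N0 : 0 <= N by rewrite addr_ge0.
have mD : measurable (D : set (borelplane R)) by apply: measurableX; exact: measurable_itv.
have KD x : K x -> D x.
  move=> /KM; rewrite ge_max => /andP[].
  rewrite !ler_norml => /andP[? ?] /andP[? ?]; split; rewrite /= in_itv/=;
    by apply/andP; split; rewrite /N; lra.
have -> : EFin \o F = ((EFin \o F) \_ D).
  apply/funext => x; rewrite patchE; case: ifPn => // /negP xD.
  by rewrite /= FK// => /KD /mem_set.
apply/(integrable_restrict _ (measurable_lebplane _ mD)) => //.
rewrite setTI; apply: measurable_bounded_integrable.
- exact: measurable_lebplane.
- by rewrite /D vol_rectangle ?ltry// mulr_ge0.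
- apply: measurable_funTS; apply: measurable_fun_lebplane.
  exact: continuous_measurable_plane.
- have /compact_bounded[C [_ CK]] : compact [set F x | x in K].
    by apply: continuous_compact => //; exact: continuous_subspaceT.
  have C0 : C < `|C| + 1 by rewrite (le_lt_trans (ler_norm C))// ltrDl.
  exists (`|C| + 1); split; first exact: num_real.
  move=> t Ct x _ /=; have [Kx|nKx] := pselect (K x).
    by apply: CK; [exact: lt_trans Ct|exists x].
  by rewrite FK// normr0 (le_trans _ (ltW Ct))// addr_ge0.
Qed.

Lemma integral_derivative_eq0 {R : realType} (M : R) (g dg : R -> R) : 0 < M ->
  (forall x : R, is_derive x 1 g (dg x)) -> continuous dg ->
  (forall x, ~ (- M <= x <= M) -> g x = 0) ->
  (\int[lebesgue_measure]_x (dg x)%:E = 0)%E.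
Proof.
move=> M0 Dg cdg g0.
have cg : continuous g.
  by move=> x; apply/differentiable_continuous/derivable1_diffP.
have dg0 x : ~ (- M <= x <= M) -> dg x = 0.
  move=> xM; have [_ <-] := Dg x.
  rewrite (@near_eq_derive _ _ _ g (cst 0)) ?derive_cst//.
  move/negP: xM; rewrite negb_and -!ltNge => /orP[] h; near=> y; apply: g0; apply/negP;
    rewrite negb_and -!ltNge; apply/orP; [left|right]; near: y.
    exact: lt_nbhsl.
  exact: lt_nbhsr.
(* The interval is widened by 1 on each side so that its endpoints fall where [g] vanishes by
   hypothesis. *)
rewrite (_ : (fun x => _) = (EFin \o dg) \_ `[- M - 1, M + 1]); last first.
  apply/funext => x; rewrite patchE; case: ifPn => //= /negP xM; congr EFin.
  apply: dg0 => /andP[? ?]; apply: xM; rewrite inE/= in_itv/=; apply/andP; split; lra.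
rewrite -integral_mkcond (@continuous_FTC2 _ dg g)//; last 4 first.
- lra.
- exact: continuous_subspaceT.
- split; first by move=> x _; exact: ex_derive.
  + by apply: cvg_at_right_filter; exact: cg.
  + by apply: cvg_at_left_filter; exact: cg.
- by move=> x _; rewrite derive1E; have [_ ->] := Dg x.
by rewrite !g0 ?subee//; move/andP => [? ?]; lra.
Unshelve. all: by end_near. Qed.

Lemma is_derive_line {R : realType} (F : R * R -> R) (v p : R * R) (x : R) :
  derivable F (x *: v + p) v ->
  is_derive x 1 (fun h => F (h *: v + p)) ('D_v F (x *: v + p)).
Proof.
move=> dF; have E : (fun h : R => h^-1 *: (F (h *: v + (x *: v + p)) - F (x *: v + p))) =
    (fun h : R => h^-1 *: (((fun h => F (h *: v + p)) \o shift x) (h *: 1) - F (x *: v + p))).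
  by apply/funext => h /=; rewrite [_%:A]mulr1 scalerDl addrA.
by split; [|rewrite /derive]; rewrite /derivable /= -E.
Qed.

Lemma derive_outside {R : realType} (K : set (R * R)) (F : R * R -> R)
    (v x : R * R) :
  closed K -> (forall x, ~ K x -> F x = 0) -> ~ K x -> 'D_v F x = 0.
Proof.
move=> KC FK nKx; rewrite (@near_eq_derive _ _ _ F (cst 0)) ?derive_cst//.
have : nbhs x (~` K) by apply: open_nbhs_nbhs; split=> //; exact: closed_openC.
by apply: filterS => y; exact: FK.
Qed.

(** Fubini with the integration along [v] done first: on each line parallel to [v] the function has
    bounded support, so its derivative integrates to 0. This is the integration by parts behind the
    positivity of H_B. *)
Lemma integral_partial_eq0 {R : realType} (K : set (R * R)) (F : R * R -> R)
    (v : R * R) :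
  v = e1 R \/ v = e2 R ->
  compact K -> (forall x, ~ K x -> F x = 0) ->
  (forall x, derivable F x v) -> continuous ('D_v F) ->
  (vol R).-integrable setT (EFin \o 'D_v F) /\
  (\int[vol R]_x ('D_v F x)%:E = 0)%E.
Proof.
move=> ve cK FK dF cDF.
have KC : closed K by apply: compact_closed => //; exact: norm_hausdorff.
have DFK x : ~ K x -> 'D_v F x = 0 by exact: derive_outside.
have int := continuous_integrable_vol _ _ cK cDF DFK.
split => //.
have mDF : measurable_fun setT (EFin \o 'D_v F : borelplane R -> _).
  by apply/measurable_EFinP; exact: continuous_measurable_plane.
have [intp ->] := integral_vol _ mDF int.
have [M [_ KM]] := compact_bounded cK.
have {KM} KM x : K x -> `|x| <= `|M| + 1.
  by move=> Kx; apply: (KM (`|M| + 1)) => //; rewrite (le_lt_trans (ler_norm M))// ltrDl.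
have M1 : 0 < `|M| + 1 by rewrite ltr_wpDl.
case: ve => ve; subst v.
- have slice (y : R) : (\int[lebesgue_measure]_x ('D_(e1 R) F (x, y))%:E = 0)%E.
    have E x : (x, y) = x *: e1 R + (0, y).
      by rewrite /e1; congr pair; rewrite /= ?scaler0 ?[_%:A]mulr1 ?addr0 ?add0r.
    apply: (@integral_derivative_eq0 _ (`|M| + 1) (fun x => F (x *: e1 R + (0, y)))
      (fun x : R => 'D_(e1 R) F (x, y))) => //.
    + by move=> x; rewrite (E x); exact: (is_derive_line F _ _ x (dF _)).
    + move=> x; apply: (@continuous_comp _ _ _ (fun t : R => (t, y)) ('D_(e1 R) F)); last exact: cDF.
      exact: (cvg_pair cvg_id (cvg_cst _)).
    + move=> x xM; apply: FK; rewrite -E => /KM; rewrite ge_max => /andP[+ _].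
      by rewrite ler_norml.
  by rewrite -integral21_prod_meas1// /fubini_G; under eq_integral do rewrite slice;
    rewrite integral0.
- have slice (y : R) : (\int[lebesgue_measure]_x ('D_(e2 R) F (y, x))%:E = 0)%E.
    have E x : (y, x) = x *: e2 R + (y, 0).
      by rewrite /e2; congr pair; rewrite /= ?scaler0 ?[_%:A]mulr1 ?addr0 ?add0r.
    apply: (@integral_derivative_eq0 _ (`|M| + 1) (fun x => F (x *: e2 R + (y, 0)))
      (fun x : R => 'D_(e2 R) F (y, x))) => //.
    + by move=> x; rewrite (E x); exact: (is_derive_line F _ _ x (dF _)).
    + move=> x; apply: (@continuous_comp _ _ _ (fun t : R => (y, t)) ('D_(e2 R) F)); last exact: cDF.
      exact: (cvg_pair (cvg_cst _) cvg_id).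
    + move=> x xM; apply: FK; rewrite -E => /KM; rewrite ge_max => /andP[_ +].
      by rewrite ler_norml.
  by rewrite -integral12_prod_meas1// /fubini_F; under eq_integral do rewrite slice;
    rewrite integral0.
Qed.

(** * The squared L^2 norm *)

Lemma vol_aeW {R : realType} (P : R * R -> Prop) :
  (forall x, P x) -> {ae vol R, forall x, P x}.
Proof. by move=> aP; exact: (@filterE _ _ (ae_filter_ringOfSetsType (vol R)) P). Qed.

Lemma vol_aeS {R : realType} (P Q : R * R -> Prop) :
  {ae vol R, forall x, P x} -> (forall x, P x -> Q x) -> {ae vol R, forall x, Q x}.
Proof.
move=> aeP PQ; apply: (@filterS _ _ (ae_filter_ringOfSetsType (vol R)) P Q) => //.
Qed.

Lemma vol_aeI {R : realType} (P Q : R * R -> Prop) :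
  {ae vol R, forall x, P x} -> {ae vol R, forall x, Q x} ->
  {ae vol R, forall x, P x /\ Q x}.
Proof.
by move=> aeP aeQ; exact: (@filterI _ _ (ae_filter_ringOfSetsType (vol R)) P Q).
Qed.

Definition mod2 {R : realType} (z : R[i]) : R :=
  complex.Re z ^+ 2 + complex.Im z ^+ 2.

Definition l2norm2 {R : realType} (u : R * R -> R[i]) : R :=
  fine (sqnorm setT u).

Definition measurableC {R : realType} (u : R * R -> R[i]) : Prop :=
  measurable_fun setT (fun x : lebplane R => complex.Re (u x)) /\
  measurable_fun setT (fun x : lebplane R => complex.Im (u x)).

Lemma mod2_ge0 {R : realType} (z : R[i]) : 0 <= mod2 z.
Proof. by rewrite addr_ge0 ?sqr_ge0. Qed.

Lemma mod2M {R : realType} (z w : R[i]) : mod2 (z * w) = mod2 z * mod2 w.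
Proof. by case: z w => a b [c d]; rewrite /mod2 /=; ring. Qed.

Lemma mod2_real {R : realType} (a : R) : mod2 a%:C%C = a ^+ 2.
Proof. by rewrite /mod2 /= expr0n addr0. Qed.

Lemma mod2_1 {R : realType} : mod2 (1 : R[i]) = 1.
Proof. by rewrite (mod2_real 1) expr1n. Qed.

Lemma mod2N {R : realType} (z : R[i]) : mod2 (- z) = mod2 z.
Proof. by case: z => a b; rewrite /mod2 /= !sqrrN. Qed.

(** Young's inequality 2 x y <= d x^2 + y^2 / d on real and imaginary parts. A small [d] keeps the
    coefficient of the main term [z] close to 1, at the price of a large one on the perturbation
    [w]. *)
Lemma mod2D_le {R : realType} (d : R) (z w : R[i]) : 0 < d ->
  mod2 (z + w) <= (1 + d) * mod2 z + (1 + d^-1) * mod2 w.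
Proof.
move=> d0; case: z w => a b [a' b']; rewrite /mod2 /=.
have H (x y : R) : 2 * (x * y) <= d * x ^+ 2 + d^-1 * y ^+ 2.
  rewrite -subr_ge0 (_ : _ - _ = d^-1 * (d * x - y) ^+ 2).
    by rewrite mulr_ge0 ?sqr_ge0// invr_ge0 ltW.
  by field; rewrite gt_eqF.
have Ha := H a a'; have Hb := H b b'.
rewrite -subr_ge0 (_ : _ - _ = (d * a ^+ 2 + d^-1 * a' ^+ 2 - 2 * (a * a')) +
  (d * b ^+ 2 + d^-1 * b' ^+ 2 - 2 * (b * b'))); last by ring.
by rewrite addr_ge0// subr_ge0.
Qed.

Lemma measurable_mod2 {R : realType} (u : R * R -> R[i]) : measurableC u ->
  measurable_fun setT (fun x : lebplane R => mod2 (u x)).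
Proof. by case=> mr mi; apply: measurable_funD; exact: measurable_funX. Qed.

Lemma measurableC_lin {R : realType} (a b : R[i]) (u v : R * R -> R[i]) :
  measurableC u -> measurableC v -> measurableC (fun x => a * u x + b * v x).
Proof.
move=> [ur ui] [vr vi]; split.
- rewrite (_ : (fun x => _) = (fun x : lebplane R =>
    (complex.Re a * complex.Re (u x) - complex.Im a * complex.Im (u x)) +
    (complex.Re b * complex.Re (v x) - complex.Im b * complex.Im (v x)))).
    by apply: measurable_funD; apply: measurable_funB; apply: measurable_funM.
  by apply/funext => x; case: (a) (b) (u x) (v x) => ? ? [? ?] [? ?] [? ?].
- rewrite (_ : (fun x => _) = (fun x : lebplane R =>
    (complex.Re a * complex.Im (u x) + complex.Im a * complex.Re (u x)) +
    (complex.Re b * complex.Im (v x) + complex.Im b * complex.Re (v x)))).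
    by apply: measurable_funD; apply: measurable_funD; apply: measurable_funM.
  by apply/funext => x; case: (a) (b) (u x) (v x) => ? ? [? ?] [? ?] [? ?].
Qed.

Lemma sqnorm_ge0 {R : realType} S (u : R * R -> R[i]) : (0 <= sqnorm S u)%E.
Proof. by apply: integral_ge0 => x _; rewrite lee_fin mod2_ge0. Qed.

(** Norms are compared through pointwise bounds. These are asked only almost everywhere because
    linearity and the semigroup law hold only in that sense. *)
Lemma sqnorm_dominated {R : realType} (S : set (R * R)) (a b : R)
    (w u v : R * R -> R[i]) :
  lebesgue_measurable S -> 0 <= a -> 0 <= b ->
  measurableC w -> measurableC u -> measurableC v ->
  {ae vol R, forall x, mod2 (w x) <= a * mod2 (u x) + b * mod2 (v x)} ->
  (sqnorm S w <= a%:E * sqnorm S u + b%:E * sqnorm S v)%E.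
Proof.
move=> mS a0 b0 mw mu mv wuv.
have m f : measurableC f ->
    measurable_fun (S : set (lebplane R)) (fun x => (mod2 (f x))%:E).
  by move=> mf; apply/measurable_EFinP; apply: measurable_funTS; exact: measurable_mod2.
have mS' : measurable (S : set (lebplane R)) by exact: mS.
have Z c f : 0 <= c -> measurableC f ->
    (\int[vol R]_(x in S) (c%:E * (mod2 (f x))%:E) = c%:E * sqnorm S f)%E.
  move=> c0 mf; apply: (ge0_integralZl_EFin (vol R) mS' _ (m _ mf) c0) => x _.
  by rewrite lee_fin mod2_ge0.
have mZ c f : measurableC f ->
    measurable_fun (S : set (lebplane R)) (fun x => c%:E * (mod2 (f x))%:E)%E.
  by move=> mf; apply: measurable_funeM; exact: m.
have Z0 c f x : 0 <= c -> (0 <= c%:E * (mod2 (f x))%:E)%E.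
  by move=> c0; rewrite -EFinM lee_fin mulr_ge0// mod2_ge0.
have D : (\int[vol R]_(x in S) (a%:E * (mod2 (u x))%:E + b%:E * (mod2 (v x))%:E)
    = a%:E * sqnorm S u + b%:E * sqnorm S v)%E.
  rewrite -(Z a u a0 mu) -(Z b v b0 mv).
  refine (@ge0_integralD _ _ _ (vol R) S mS' (fun x => a%:E * (mod2 (u x))%:E)%E
    (fun x => b%:E * (mod2 (v x))%:E)%E _ (mZ a u mu) _ (mZ b v mv)).
  - by move=> x _; exact: Z0.
  - by move=> x _; exact: Z0.
rewrite -D.
apply: (ae_ge0_le_integral mS').
- by move=> x _; rewrite lee_fin mod2_ge0.
- exact: m.
- by move=> x _; rewrite adde_ge0// Z0.
- by apply: emeasurable_funD; exact: mZ.
- by apply: (vol_aeS _ _ wuv) => x {}wuv _; rewrite -!EFinM -EFinD lee_fin.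
Qed.

Lemma sqintegrable_measurable {R : realType} (u : R * R -> R[i]) :
  sqintegrable u -> measurableC u.
Proof. by case. Qed.

Lemma sqnormTE {R : realType} (u : R * R -> R[i]) : sqintegrable u ->
  sqnorm setT u = (l2norm2 u)%:E.
Proof. by case=> _ _ fu; rewrite fineK// ge0_fin_numE// sqnorm_ge0. Qed.

Lemma l2norm2_ge0 {R : realType} (u : R * R -> R[i]) : 0 <= l2norm2 u.
Proof. by rewrite fine_ge0// sqnorm_ge0. Qed.

Lemma sqintegrable_dominated {R : realType} (a b : R) (w u v : R * R -> R[i]) :
  0 <= a -> 0 <= b -> measurableC w -> sqintegrable u -> sqintegrable v ->
  {ae vol R, forall x, mod2 (w x) <= a * mod2 (u x) + b * mod2 (v x)} ->
  sqintegrable w /\ l2norm2 w <= a * l2norm2 u + b * l2norm2 v.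
Proof.
move=> a0 b0 mw lu lv wuv.
have := sqnorm_dominated _ _ _ _ _ _ (measurable_lebplane _ measurableT) a0 b0 mw
  (sqintegrable_measurable _ lu) (sqintegrable_measurable _ lv) wuv.
rewrite (sqnormTE u lu) (sqnormTE v lv) -!EFinM -EFinD => h.
have lw : sqintegrable w.
  by case: mw => ? ?; split=> //; rewrite (le_lt_trans h)// ltry.
by split; [exact: lw|move: h; rewrite (sqnormTE w lw) lee_fin].
Qed.

Lemma sqintegrable_lin {R : realType} (a b : R[i]) (u v : R * R -> R[i]) :
  sqintegrable u -> sqintegrable v ->
  sqintegrable (fun x => a * u x + b * v x).
Proof.
move=> lu lv; apply: (sqintegrable_dominated (2 * mod2 a) (2 * mod2 b) _ u v _ _ _ lu lv _).1.
- by rewrite mulr_ge0// mod2_ge0.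
- by rewrite mulr_ge0// mod2_ge0.
- by apply: measurableC_lin; exact: sqintegrable_measurable.
- apply: vol_aeW => x; apply: (le_trans (mod2D_le 1 _ _ ltr01)).
  by rewrite !mod2M invr1 !mulrA.
Qed.

Lemma l2norm2_ae {R : realType} (u v : R * R -> R[i]) :
  sqintegrable u -> sqintegrable v -> ae_equal u v -> l2norm2 u = l2norm2 v.
Proof.
have le (f g : R * R -> R[i]) : sqintegrable f -> sqintegrable g ->
    ae_equal f g -> l2norm2 f <= l2norm2 g.
  move=> lf lg fg; have [] := sqintegrable_dominated 1 0 f g g ler01 (lexx 0)
    (sqintegrable_measurable _ lf) lg lg.
    by apply: (vol_aeS _ _ fg) => x ->; rewrite mul1r mul0r addr0.
  by rewrite mul1r mul0r addr0.
move=> lu lv uv; apply/eqP; rewrite eq_le !le//.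
by apply: (vol_aeS _ _ uv) => x ->.
Qed.

Lemma l2norm2Z {R : realType} (c : R[i]) (u : R * R -> R[i]) :
  sqintegrable u -> l2norm2 (fun x => c * u x) = mod2 c * l2norm2 u.
Proof.
move=> lu; have m : measurable_fun setT (fun x : lebplane R => (mod2 (u x))%:E).
  by apply/measurable_EFinP; apply: measurable_mod2; exact: sqintegrable_measurable.
have E : (sqnorm setT (fun x => c * u x)%R = (mod2 c)%:E * sqnorm setT u)%E.
  transitivity (\int[vol R]_x ((mod2 c)%:E * (mod2 (u x))%:E))%E.
    by apply: eq_integral => x _; rewrite -EFinM -mod2M.
  apply: (ge0_integralZl_EFin (vol R) measurableT _ m (mod2_ge0 c)) => x _.
  by rewrite lee_fin mod2_ge0.
by rewrite /l2norm2 E (sqnormTE u lu).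
Qed.

Lemma l2norm2_lin_le {R : realType} (d : R) (a b : R[i]) (u v : R * R -> R[i]) :
  0 < d -> sqintegrable u -> sqintegrable v ->
  l2norm2 (fun x => a * u x + b * v x) <=
    (1 + d) * (mod2 a * l2norm2 u) + (1 + d^-1) * (mod2 b * l2norm2 v).
Proof.
move=> d0 lu lv; rewrite !mulrA; apply: (sqintegrable_dominated _ _ _ u v _ _ _ lu lv _).2.
- by rewrite mulr_ge0 ?mod2_ge0// addr_ge0// ltW.
- by rewrite mulr_ge0 ?mod2_ge0// addr_ge0// invr_ge0 ltW.
- exact: (measurableC_lin a b _ _ (sqintegrable_measurable _ lu) (sqintegrable_measurable _ lv)).
- by apply: vol_aeW => x; apply: (le_trans (mod2D_le d _ _ d0)); rewrite !mod2M !mulrA.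
Qed.

(** * Functions of class C^oo *)

(** Both sides have the same difference quotient. This makes the one-variable chain rule available
    for directional derivatives. *)
Lemma derive_line1 {R : realType} (V : normedModType R) (F : V -> R) (x v : V) (d : R) :
  is_derive x v F d <-> is_derive (0 : R) 1 (fun t : R => F (t *: v + x)) d.
Proof.
have E : (fun h : R => h^-1 *: (F (h *: v + x) - F x)) =
    (fun h : R => h^-1 *: (((fun t : R => F (t *: v + x)) \o shift 0) (h *: 1)
       - F ((0 : R) *: v + x))).
  by apply/funext => h /=; rewrite [_%:A]mulr1 addr0 scale0r add0r.
split => -[dF <-]; split.
- by move: dF; rewrite /derivable /= E.
- by rewrite /derive /= -E.
- by rewrite /derivable E.
- by rewrite /derive E.
Qed.

Lemma is_derive_comp {R : realType} (V : normedModType R) (h : R -> R)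
    (f : V -> R) (x v : V) (dh df : R) :
  is_derive (f x) 1 h dh -> is_derive x v f df ->
  is_derive x v (h \o f) (dh * df).
Proof.
move=> Dh /derive_line1 Df; apply/derive_line1.
apply: (is_derive1_comp (f := h) (g := fun t : R => f (t *: v + x))) => //.
by rewrite scale0r add0r.
Qed.

Lemma of_class_C_continuous {R : realType} n (f : R * R -> R) :
  of_class_C n f -> continuous f.
Proof. by case: n => [|n] => [|[]]. Qed.

Lemma of_class_CW {R : realType} n (f : R * R -> R) :
  of_class_C n.+1 f -> of_class_C n f.
Proof.
elim: n f => [|n IHn] f [cf df c1 c2]; first exact: cf.
by split; [exact: cf|exact: df|exact: (IHn _ c1)|exact: (IHn _ c2)].
Qed.

Lemma of_class_CS {R : realType} n (f f1 f2 : R * R -> R) :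
  continuous f ->
  (forall x, is_derive x (e1 R) f (f1 x)) ->
  (forall x, is_derive x (e2 R) f (f2 x)) ->
  of_class_C n f1 -> of_class_C n f2 -> of_class_C n.+1 f.
Proof.
move=> cf d1 d2 c1 c2.
have E1 : 'D_(e1 R) f = f1 by apply/funext => x; have [_ ->] := d1 x.
have E2 : 'D_(e2 R) f = f2 by apply/funext => x; have [_ ->] := d2 x.
split; [exact: cf| |by rewrite E1|by rewrite E2] => x.
by have [h1 _] := d1 x; have [h2 _] := d2 x.
Qed.

Lemma of_class_CSP {R : realType} n (f : R * R -> R) : of_class_C n.+1 f ->
  [/\ continuous f, forall x, is_derive x (e1 R) f ('D_(e1 R) f x),
      forall x, is_derive x (e2 R) f ('D_(e2 R) f x),
      of_class_C n ('D_(e1 R) f) & of_class_C n ('D_(e2 R) f)].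
Proof.
move=> [cf df c1 c2]; split; [exact: cf| | |exact: c1|exact: c2] => x;
  by apply: derivableP; have [] := df x.
Qed.

Lemma of_class_C_cst {R : realType} n (c : R) : of_class_C n (fun _ => c).
Proof.
elim: n c => [|n IHn] c; first exact: cst_continuous.
apply: (of_class_CS n _ (fun _ => 0) (fun _ => 0)).
- exact: cst_continuous.
- exact: (IHn 0).
- exact: (IHn 0).
Qed.

Lemma is_derive_fst {R : realType} (x v : R * R) : is_derive x v fst v.1.
Proof.
apply/derive_line1; rewrite (_ : (fun t : R => _) = (fun t => t * v.1 + x.1))//.
by apply: is_derive_eq; rewrite /= ?scaler0 ?add0r ?addr0 [_%:A]mulr1.
Qed.

Lemma is_derive_snd {R : realType} (x v : R * R) : is_derive x v snd v.2.
Proof.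
apply/derive_line1; rewrite (_ : (fun t : R => _) = (fun t => t * v.2 + x.2))//.
by apply: is_derive_eq; rewrite /= ?scaler0 ?add0r ?addr0 [_%:A]mulr1.
Qed.

Lemma of_class_C_fst {R : realType} n : of_class_C n (@fst R R).
Proof.
case: n => [|n]; first by move=> x; exact: cvg_fst.
apply: (of_class_CS n _ (fun _ => 1) (fun _ => 0)); last 2 first.
- exact: (of_class_C_cst n 1).
- exact: (of_class_C_cst n 0).
- by move=> x; exact: cvg_fst.
- by move=> x; exact: is_derive_fst.
- by move=> x; exact: is_derive_fst.
Qed.

Lemma of_class_C_snd {R : realType} n : of_class_C n (@snd R R).
Proof.
case: n => [|n]; first by move=> x; exact: cvg_snd.
apply: (of_class_CS n _ (fun _ => 0) (fun _ => 1)); last 2 first.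
- exact: (of_class_C_cst n 0).
- exact: (of_class_C_cst n 1).
- by move=> x; exact: cvg_snd.
- by move=> x; exact: is_derive_snd.
- by move=> x; exact: is_derive_snd.
Qed.

Lemma of_class_CD {R : realType} n (f g : R * R -> R) :
  of_class_C n f -> of_class_C n g -> of_class_C n (fun x => f x + g x).
Proof.
elim: n f g => [|n IHn] f g.
  by move=> cf cg x; exact: (cvgD (cf x) (cg x)).
move=> /of_class_CSP[cf f1 f2 cf1 cf2] /of_class_CSP[cg g1 g2 cg1 cg2].
apply: (of_class_CS n _ (fun x => 'D_(e1 R) f x + 'D_(e1 R) g x)
  (fun x => 'D_(e2 R) f x + 'D_(e2 R) g x)).
- by move=> x; exact: (cvgD (cf x) (cg x)).
- exact: (IHn _ _ cf1 cg1).
- exact: (IHn _ _ cf2 cg2).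
Qed.

Lemma of_class_CM {R : realType} n (f g : R * R -> R) :
  of_class_C n f -> of_class_C n g -> of_class_C n (fun x => f x * g x).
Proof.
elim: n f g => [|n IHn] f g.
  by move=> cf cg x; exact: (cvgM (cf x) (cg x)).
move=> Cf Cg; have fn := of_class_CW _ _ Cf; have gn := of_class_CW _ _ Cg.
move: Cf Cg => /of_class_CSP[cf f1 f2 cf1 cf2] /of_class_CSP[cg g1 g2 cg1 cg2].
apply: (of_class_CS n _ (fun x => f x * 'D_(e1 R) g x + g x * 'D_(e1 R) f x)
  (fun x => f x * 'D_(e2 R) g x + g x * 'D_(e2 R) f x)).
- by move=> x; exact: (cvgM (cf x) (cg x)).
- exact: (of_class_CD _ _ _ (IHn _ _ fn cg1) (IHn _ _ gn cf1)).
- exact: (of_class_CD _ _ _ (IHn _ _ fn cg2) (IHn _ _ gn cf2)).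
Qed.

(** The derivative of h(f) is h'(f) times a derivative of f, so the induction on [n] must apply to
    h' as well. Hence a whole family [A] stable under differentiation: the exponential alone, the
    combinations of cos and sin, the functions [bump p]. *)
Lemma of_class_C_comp {R : realType} (A : (R -> R) -> Prop) :
  (forall h, A h -> exists2 h', A h' & forall x : R, is_derive x 1 h (h' x)) ->
  forall n h (f : R * R -> R), A h -> of_class_C n f ->
  of_class_C n (fun x => h (f x)).
Proof.
move=> AD; have Ac h : A h -> continuous h.
  move=> /AD[h' _ hh'] x.
  by apply/differentiable_continuous/derivable1_diffP.
elim=> [|n IHn] h f Ah.
  by move=> cf x; apply: (@continuous_comp _ _ _ f h); [exact: cf|exact: Ac].
have [h' Ah' hh'] := AD _ Ah.
move=> Cf; have fn := of_class_CW _ _ Cf; move: Cf => /of_class_CSP[cf f1 f2 cf1 cf2].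
apply: (of_class_CS n _ (fun x => h' (f x) * 'D_(e1 R) f x)
  (fun x => h' (f x) * 'D_(e2 R) f x)).
- by move=> x; apply: (@continuous_comp _ _ _ f h); [exact: cf|exact: Ac].
- by move=> x; exact: is_derive_comp.
- by move=> x; exact: is_derive_comp.
- exact: (of_class_CM _ _ _ (IHn _ _ Ah' fn) cf1).
- exact: (of_class_CM _ _ _ (IHn _ _ Ah' fn) cf2).
Qed.

Lemma of_class_C_expR {R : realType} n (f : R * R -> R) :
  of_class_C n f -> of_class_C n (fun x => expR (f x)).
Proof.
apply: (of_class_C_comp (eq (@expR R))) => // h <-.
by exists (@expR R) => // x; exact: is_derive_expR.
Qed.

Lemma of_class_C_trig {R : realType} n (a b : R) (f : R * R -> R) :
  of_class_C n f -> of_class_C n (fun x => a * cos (f x) + b * sin (f x)).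
Proof.
pose A (h : R -> R) := exists a b, h = fun x => a * cos x + b * sin x.
apply: (of_class_C_comp A _ n (fun x => a * cos x + b * sin x)); last by exists a, b.
move=> h [{}a [{}b ->]].
exists (fun x => b * cos x + - a * sin x); first by exists b, (- a).
move=> x; apply: is_derive_eq.
by rewrite /GRing.scale /=; ring.
Qed.

(* The functions p(1/s) exp(-1/s), extended by 0 to s <= 0: a family closed under
   differentiation. *)
Definition bump {R : realType} (p : {poly R}) (s : R) : R :=
  if 0 < s then p.[s^-1] * expR (- s^-1) else 0.

(** Induction on the Horner form with the rate [c] generalized: half of the rate controls the
    quotient polynomial, the other half absorbs the extra factor t through c t / 2 <= exp(c t /
    2). *)
Lemma poly_le_expR {R : realType} (p : {poly R}) (c : R) : 0 < c ->
  exists2 C, 0 < C & forall t, 0 <= t -> `|p.[t]| <= C * expR (c * t).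
Proof.
elim/poly_ind: p c => [|p a IHp] c c0.
  by exists 1 => // t _; rewrite horner0 normr0 mul1r expR_ge0.
have c2 : 0 < c / 2 by rewrite divr_gt0.
have [C C0 pC] := IHp _ c2.
exists (C * (c / 2)^-1 + `|a|); first by rewrite ltr_wpDr// mulr_gt0// invr_gt0.
move=> t t0; rewrite hornerMXaddC (le_trans (ler_normD _ _))// mulrDl lerD//.
  have E1 : t <= (c / 2)^-1 * expR (c / 2 * t).
    rewrite -(ler_pM2l c2) mulrA mulfV ?gt_eqF// mul1r.
    by rewrite (le_trans _ (expR_ge1Dx _))// lerDr.
  rewrite normrM (ger0_norm t0) (le_trans (ler_pM _ _ (pC _ t0) E1))//.
  rewrite le_eqVlt; apply/orP; left; apply/eqP.
  rewrite (_ : c * t = c / 2 * t + c / 2 * t) ?expRD; last by field.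
  by ring.
rewrite ler_peMr// (le_trans _ (expR_ge1Dx _))// lerDl mulr_ge0// ltW//.
Qed.

Lemma bump_bounded {R : realType} (p : {poly R}) :
  exists2 C, 0 < C & forall s, `|bump p s| <= C.
Proof.
have [C C0 pC] := poly_le_expR p 1 ltr01; exists C => // s.
rewrite /bump; case: ifPn => [s0|_]; last by rewrite normr0 ltW.
rewrite normrM (ger0_norm (expR_ge0 _)).
have si : 0 <= s^-1 by rewrite invr_ge0 ltW.
rewrite (le_trans (ler_wpM2r (expR_ge0 _) (pC _ si)))//.
by rewrite mul1r -mulrA -expRD subrr expR0 mulr1.
Qed.

(** Differentiating p(1/s) exp(-1/s) gives (p - p')(1/s) s^-2 exp(-1/s), and s^-2 is the value of
    ['X^2] at 1/s. Only the point s = 0 is delicate. *)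
Lemma is_derive_bump {R : realType} (p : {poly R}) (s : R) :
  is_derive s 1 (bump p) (bump ((p - p^`()) * 'X^2) s).
Proof.
have [s0|s0|s0] := ltgtP s 0.
- rewrite [X in is_derive _ _ _ X]/bump ltNge (ltW s0)/=.
  apply: (@near_eq_is_derive _ _ _ (cst 0)) => //.
  near=> t; rewrite /bump ltNge (_ : t <= 0)//.
  by apply: ltW; near: t; exact: lt_nbhsl.
- rewrite [X in is_derive _ _ _ X]/bump s0.
  apply: (@near_eq_is_derive _ _ _ (fun t : R => p.[t^-1] * expR (- t^-1))).
    near=> t; rewrite /bump (_ : 0 < t)//.
    by near: t; exact: lt_nbhsr.
  have Dv : is_derive s 1 (fun t : R => t^-1) (- s ^- 2).
    have s1 : s != 0 by rewrite gt_eqF.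
    have := @is_deriveV _ (id : R -> R) s 1 1 s1 (is_derive_id _ _).
    by rewrite [_ *: 1]mulr1.
  have Dp : is_derive s 1 (fun t : R => p.[t^-1]) (p^`().[s^-1] * (- s ^- 2)).
    exact: (is_derive1_comp (f := horner p) (g := fun t : R => t^-1)).
  have De : is_derive s 1 (fun t : R => expR (- t^-1)) (expR (- s^-1) * (s ^- 2)).
    apply: (is_derive1_comp (f := @expR R) (g := fun t : R => - t^-1)).
    by apply: is_derive_eq; rewrite opprK.
  apply: is_derive_eq; rewrite /GRing.scale /= hornerM hornerXn hornerD hornerN.
  by field; rewrite gt_eqF.
- rewrite s0 {2}/bump ltxx.
  (* Boundedness of [bump (p * 'X^2)] means that [bump p t] is O(t^2), so the difference quotient at
     0 is O(t). *)
  have [C C0 pC] := bump_bounded (p * 'X^2).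
  have le t : `|bump p t| <= C * `|t| * `|t|.
    have := pC t; rewrite /bump; case: ifPn => [t0 h|_ _]; last first.
      by rewrite normr0 !mulr_ge0// ltW.
    have t2 : 0 < t ^+ 2 by rewrite exprn_gt0.
    move: h; rewrite hornerM hornerXn -(ler_pM2r t2) => h.
    rewrite -mulrA -expr2 real_normK ?num_real// (le_trans _ h)//.
    rewrite [leRHS](_ : _ = `|p.[t^-1] * expR (- t^-1)|)//.
    rewrite -[X in _ * X = _](ger0_norm (ltW t2)) -normrM; congr `|_|.
    by field; rewrite gt_eqF.
  have lim : h^-1 *: (bump p (h *: 1 + 0) - bump p 0) @[h --> (0 : R)^'] --> (0 : R).
    apply: (@cvg_to_0_linear _ _ C 1) => // r /andP[r0 _].
    rewrite [_%:A]mulr1 addr0 [bump p 0]/bump ltxx subr0 normrM.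
    by rewrite normfV mulrC ler_pdivrMr.
  split; first by apply/cvg_ex; exists 0.
  by apply/cvg_lim => //; exact: norm_hausdorff.
Unshelve. all: by end_near. Qed.

Lemma of_class_C_bump {R : realType} n p (f : R * R -> R) :
  of_class_C n f -> of_class_C n (fun x => bump p (f x)).
Proof.
apply: (of_class_C_comp (fun h => exists p, h = bump p)); last by exists p.
move=> h [q ->]; exists (bump ((q - q^`()) * 'X^2)); first by eexists.
exact: is_derive_bump.
Qed.

(** * Accretivity of the Landau operator *)

(** Smoothness apart from the support condition of [test_function]. The support is tracked by a
    separate closed or compact [K], which serves unchanged for all magnetic derivatives of u. *)
Definition smoothC {R : realType} (u : R * R -> R[i]) : Prop :=
  (forall n, of_class_C n (fun x => complex.Re (u x))) /\
  (forall n, of_class_C n (fun x => complex.Im (u x))).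

Lemma Re_magnetic1 {R : realType} (B : R) (u : R * R -> R[i]) x :
  complex.Re (magnetic1 B u x) =
  - 'D_(e1 R) (fun y => complex.Im (u y)) x - B / 2 * x.2 * complex.Re (u x).
Proof. by rewrite /magnetic1 /partial /=; case: (u x) => a b /=; ring. Qed.

Lemma Im_magnetic1 {R : realType} (B : R) (u : R * R -> R[i]) x :
  complex.Im (magnetic1 B u x) =
  'D_(e1 R) (fun y => complex.Re (u y)) x - B / 2 * x.2 * complex.Im (u x).
Proof. by rewrite /magnetic1 /partial /=; case: (u x) => a b /=; ring. Qed.

Lemma Re_magnetic2 {R : realType} (B : R) (u : R * R -> R[i]) x :
  complex.Re (magnetic2 B u x) =
  - 'D_(e2 R) (fun y => complex.Im (u y)) x + B / 2 * x.1 * complex.Re (u x).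
Proof. by rewrite /magnetic2 /partial /=; case: (u x) => a b /=; ring. Qed.

Lemma Im_magnetic2 {R : realType} (B : R) (u : R * R -> R[i]) x :
  complex.Im (magnetic2 B u x) =
  'D_(e2 R) (fun y => complex.Re (u y)) x + B / 2 * x.1 * complex.Im (u x).
Proof. by rewrite /magnetic2 /partial /=; case: (u x) => a b /=; ring. Qed.

Lemma of_class_C_lin {R : realType} n (a b : R) (f g k : R * R -> R) :
  of_class_C n f -> of_class_C n g -> of_class_C n k ->
  of_class_C n (fun x => a * f x + b * g x * k x).
Proof.
move=> cf cg ck.
exact: (of_class_CD _ _ _ (of_class_CM _ _ _ (of_class_C_cst n a) cf)
  (of_class_CM _ _ _ (of_class_CM _ _ _ (of_class_C_cst n b) cg) ck)).
Qed.

Lemma smoothC_magnetic1 {R : realType} (B : R) (u : R * R -> R[i]) :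
  smoothC u -> smoothC (magnetic1 B u).
Proof.
move=> [ru iu]; split => n.
- under [fun x => _]funext do rewrite Re_magnetic1.
  have [_ _ _ h _] := of_class_CSP _ _ (iu n.+1).
  have := of_class_C_lin n (-1) (- (B / 2)) _ _ _ h (of_class_C_snd n) (ru n).
  by congr of_class_C; apply/funext => x; ring.
- under [fun x => _]funext do rewrite Im_magnetic1.
  have [_ _ _ h _] := of_class_CSP _ _ (ru n.+1).
  have := of_class_C_lin n 1 (- (B / 2)) _ _ _ h (of_class_C_snd n) (iu n).
  by congr of_class_C; apply/funext => x; ring.
Qed.

Lemma smoothC_magnetic2 {R : realType} (B : R) (u : R * R -> R[i]) :
  smoothC u -> smoothC (magnetic2 B u).
Proof.
move=> [ru iu]; split => n.
- under [fun x => _]funext do rewrite Re_magnetic2.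
  have [_ _ _ _ h] := of_class_CSP _ _ (iu n.+1).
  have := of_class_C_lin n (-1) (B / 2) _ _ _ h (of_class_C_fst n) (ru n).
  by congr of_class_C; apply/funext => x; ring.
- under [fun x => _]funext do rewrite Im_magnetic2.
  have [_ _ _ _ h] := of_class_CSP _ _ (ru n.+1).
  have := of_class_C_lin n 1 (B / 2) _ _ _ h (of_class_C_fst n) (iu n).
  by congr of_class_C; apply/funext => x; ring.
Qed.

Lemma complex_eq0 {R : realType} (z : R[i]) :
  complex.Re z = 0 -> complex.Im z = 0 -> z = 0.
Proof. by case: z => a b /= -> ->. Qed.

Lemma magnetic_outside {R : realType} (B : R) (K : set (R * R))
    (u : R * R -> R[i]) :
  closed K -> (forall x, ~ K x -> u x = 0) ->
  forall x, ~ K x -> magnetic1 B u x = 0 /\ magnetic2 B u x = 0.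
Proof.
move=> KC uK x nKx.
have D v : 'D_v (fun y => complex.Re (u y)) x = 0 /\
    'D_v (fun y => complex.Im (u y)) x = 0.
  by split; apply: (derive_outside _ _ _ _ KC _ nKx) => y nKy; rewrite uK.
split; apply: complex_eq0.
- by rewrite Re_magnetic1 (D _).2 uK//= mulr0 subr0 oppr0.
- by rewrite Im_magnetic1 (D _).1 uK//= mulr0 subr0.
- by rewrite Re_magnetic2 (D _).2 uK//= mulr0 addr0 oppr0.
- by rewrite Im_magnetic2 (D _).1 uK//= mulr0 addr0.
Qed.

Lemma smoothCD {R : realType} (u v : R * R -> R[i]) :
  smoothC u -> smoothC v -> smoothC (fun x => u x + v x).
Proof.
move=> [ru iu] [rv iv]; split => n.
- have := of_class_CD _ _ _ (ru n) (rv n).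
  by congr of_class_C; apply/funext => x; case: (u x) (v x) => ? ? [].
- have := of_class_CD _ _ _ (iu n) (iv n).
  by congr of_class_C; apply/funext => x; case: (u x) (v x) => ? ? [].
Qed.

Lemma smoothC_integrable {R : realType} (K : set (R * R)) (u : R * R -> R[i]) :
  compact K -> smoothC u -> (forall x, ~ K x -> u x = 0) ->
  sqintegrable u /\ (vol R).-integrable setT (fun x => (mod2 (u x))%:E).
Proof.
move=> cK [ru iu] uK.
have int : (vol R).-integrable setT (fun x => (mod2 (u x))%:E).
  apply: (continuous_integrable_vol K (fun x => mod2 (u x))) => //.
    have c := of_class_CD _ _ _ (of_class_CM _ _ _ (ru 0%N) (ru 0%N))
      (of_class_CM _ _ _ (iu 0%N) (iu 0%N)).
    by move=> x; have := c x; rewrite /mod2 /=; under [fun x => _ ^+ 2 + _]funext do rewrite !expr2.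
  by move=> x nKx; rewrite uK// /mod2 /= expr0n addr0.
have m f : continuous f -> measurable_fun setT (f : lebplane R -> R).
  by move=> cf; apply: measurable_fun_lebplane; exact: continuous_measurable_plane.
split; last exact: int.
split; [exact: (m _ (ru 0%N))|exact: (m _ (iu 0%N))|].
have /integrableP[_] := int; congr (_ < _)%E.
by apply: eq_integral => x _; rewrite gee0_abs// lee_fin mod2_ge0.
Qed.

(** Expanding the square on the left, the claim amounts to 2 h Re <u, H_B u> >= 0. Writing it with
    squared norms only lets it pass to L^2 limits. *)
Lemma accretive_smooth {R : realType} (B h : R) (K : set (R * R))
    (u : R * R -> R[i]) :
  0 <= h -> compact K -> smoothC u -> (forall x, ~ K x -> u x = 0) ->
  l2norm2 (fun x => u x - h%:C%C * landau_expr B u x) <=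
    l2norm2 u + h ^+ 2 * l2norm2 (landau_expr B u).
Proof.
move=> h0 cK su uK.
have KC : closed K by apply: compact_closed => //; exact: norm_hausdorff.
have s1 := smoothC_magnetic1 B _ su; have s2 := smoothC_magnetic2 B _ su.
have K1 x (nKx : ~ K x) := (magnetic_outside B K u KC uK x nKx).1.
have K2 x (nKx : ~ K x) := (magnetic_outside B K u KC uK x nKx).2.
have s11 := smoothC_magnetic1 B _ s1; have s22 := smoothC_magnetic2 B _ s2.
have sL : smoothC (landau_expr B u) := smoothCD _ _ s11 s22.
have KL x : ~ K x -> landau_expr B u x = 0.
  move=> nKx; rewrite /landau_expr (magnetic_outside B K _ KC K1 x nKx).1.
  by rewrite (magnetic_outside B K _ KC K2 x nKx).2 addr0.
(* Re (conj u * H_B u) = |w1|^2 + |w2|^2 - d_1 (F w1) - d_2 (F w2), where w1 and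
   w2 are the magnetic derivatives of u. *)
pose F w x := complex.Re (u x) * complex.Im (w x) - complex.Im (u x) * complex.Re (w x).
have sF w : smoothC w -> forall n, of_class_C n (F w).
  move=> [rw iw] n; have := of_class_CD _ _ _ (of_class_CM _ _ _ (su.1 n) (iw n))
    (of_class_CM _ _ _ (of_class_C_cst n (-1)) (of_class_CM _ _ _ (su.2 n) (rw n))).
  by congr of_class_C; apply/funext => x; rewrite mulN1r.
have KF w x : ~ K x -> F w x = 0 by move=> nKx; rewrite /F uK//= !mul0r subrr.
have [_ F1d _ cF1 _] := of_class_CSP _ _ (sF _ s1 1%N).
have [_ _ F2d _ cF2] := of_class_CSP _ _ (sF _ s2 1%N).
have [int1 I1] := integral_partial_eq0 K _ (e1 R) (or_introl erefl) cK (KF _)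
  (fun x => @ex_derive _ _ _ _ _ _ _ (F1d x)) (of_class_C_continuous _ _ cF1).
have [int2 I2] := integral_partial_eq0 K _ (e2 R) (or_intror erefl) cK (KF _)
  (fun x => @ex_derive _ _ _ _ _ _ _ (F2d x)) (of_class_C_continuous _ _ cF2).
have [lu iu] := smoothC_integrable _ _ cK su uK.
have [lL iL] := smoothC_integrable _ _ cK sL KL.
set w1 := magnetic1 B u in s1 K1 s11 F1d cF1 int1 I1 *.
set w2 := magnetic2 B u in s2 K2 s22 F2d cF2 int2 I2 *.
have dF (v : R * R) w x :
    is_derive x v (fun y => complex.Re (u y)) ('D_v (fun y => complex.Re (u y)) x) ->
    is_derive x v (fun y => complex.Im (u y)) ('D_v (fun y => complex.Im (u y)) x) ->
    is_derive x v (fun y => complex.Re (w y)) ('D_v (fun y => complex.Re (w y)) x) ->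
    is_derive x v (fun y => complex.Im (w y)) ('D_v (fun y => complex.Im (w y)) x) ->
    'D_v (F w) x =
    complex.Re (u x) * 'D_v (fun y => complex.Im (w y)) x
      + complex.Im (w x) * 'D_v (fun y => complex.Re (u y)) x
    - (complex.Im (u x) * 'D_v (fun y => complex.Re (w y)) x
      + complex.Re (w x) * 'D_v (fun y => complex.Im (u y)) x).
  move=> du1 du2 dw1 dw2.
  exact: (@derive_val _ _ _ _ _ _ _ (is_deriveB (is_deriveM du1 dw2) (is_deriveM du2 dw1))).
have [_ r1 r2 _ _] := of_class_CSP _ _ (su.1 1%N).
have [_ i1 i2 _ _] := of_class_CSP _ _ (su.2 1%N).
have [_ r11 _ _ _] := of_class_CSP _ _ (s1.1 1%N).
have [_ i11 _ _ _] := of_class_CSP _ _ (s1.2 1%N).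
have [_ _ r22 _ _] := of_class_CSP _ _ (s2.1 1%N).
have [_ _ i22 _ _] := of_class_CSP _ _ (s2.2 1%N).
pose D x := 'D_(e1 R) (F w1) x + 'D_(e2 R) (F w2) x.
have ptw x : mod2 (u x - h%:C%C * landau_expr B u x) <=
    mod2 (u x) + h ^+ 2 * mod2 (landau_expr B u x) + 2 * h * D x.
  rewrite -subr_ge0 (_ : _ - _ = 2 * h * (mod2 (w1 x) + mod2 (w2 x))).
    by rewrite !mulr_ge0// addr_ge0 ?mod2_ge0.
  have Er : complex.Re (landau_expr B u x) =
      complex.Re (magnetic1 B w1 x) + complex.Re (magnetic2 B w2 x).
    by rewrite /landau_expr -/w1 -/w2; case: (magnetic1 B w1 x) (magnetic2 B w2 x) => ? ? [].
  have Ei : complex.Im (landau_expr B u x) =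
      complex.Im (magnetic1 B w1 x) + complex.Im (magnetic2 B w2 x).
    by rewrite /landau_expr -/w1 -/w2; case: (magnetic1 B w1 x) (magnetic2 B w2 x) => ? ? [].
  have -> : mod2 (u x - h%:C%C * landau_expr B u x) =
      (complex.Re (u x) - h * complex.Re (landau_expr B u x)) ^+ 2 +
      (complex.Im (u x) - h * complex.Im (landau_expr B u x)) ^+ 2.
    by rewrite /mod2; case: (u x) (landau_expr B u x) => ? ? [? ?] /=; ring.
  rewrite /D !dF// /mod2 Er Ei.
  rewrite (Re_magnetic1 B w1) (Im_magnetic1 B w1) (Re_magnetic2 B w2) (Im_magnetic2 B w2).
  move: (Re_magnetic1 B u x) (Im_magnetic1 B u x) (Re_magnetic2 B u x) (Im_magnetic2 B u x).
  rewrite -/w1 -/w2 => -> -> -> ->.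
  move: ('D_(e1 R) (fun y => complex.Re (u y)) x) ('D_(e1 R) (fun y => complex.Im (u y)) x)
    ('D_(e2 R) (fun y => complex.Re (u y)) x) ('D_(e2 R) (fun y => complex.Im (u y)) x)
    ('D_(e1 R) (fun y => complex.Re (w1 y)) x) ('D_(e1 R) (fun y => complex.Im (w1 y)) x)
    ('D_(e2 R) (fun y => complex.Re (w2 y)) x) ('D_(e2 R) (fun y => complex.Im (w2 y)) x).
  by move: (complex.Re (u x)) (complex.Im (u x)) (x.1) (x.2) => *; ring.
have ZD (c : R) (f g : R * R -> R) : (vol R).-integrable setT (EFin \o f) ->
    (vol R).-integrable setT (EFin \o g) ->
    (vol R).-integrable setT (EFin \o (fun x => f x + c * g x)) /\
    (\int[vol R]_x (f x + c * g x) = \int[vol R]_x f x + c * \int[vol R]_x g x)%R.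
  move=> mf mg.
  have mcg : (vol R).-integrable setT (EFin \o (fun x => c * g x)).
    exact: (integrableZl measurableT c mg).
  split; first exact: (integrableD measurableT mf mcg).
  rewrite -(RintegralZl c measurableT mg).
  exact: (RintegralD measurableT mf mcg).
have [iD ID] := ZD 1 _ _ int1 int2.
have [iuL IuL] := ZD (h ^+ 2) _ _ iu iL.
have [iuLD IuLD] := ZD (2 * h) _ _ iuL iD.
have sd : smoothC (fun x => u x - h%:C%C * landau_expr B u x).
  split => n.
  - have := of_class_CD _ _ _ (su.1 n) (of_class_CM _ _ _ (of_class_C_cst n (- h)) (sL.1 n)).
    congr of_class_C; apply/funext => x; case: (u x) (landau_expr B u x) => ? ? [? ?] /=; ring.
  - have := of_class_CD _ _ _ (su.2 n) (of_class_CM _ _ _ (of_class_C_cst n (- h)) (sL.2 n)).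
    congr of_class_C; apply/funext => x; case: (u x) (landau_expr B u x) => ? ? [? ?] /=; ring.
have [_ id] : sqintegrable (fun x => u x - h%:C%C * landau_expr B u x) /\
    (vol R).-integrable setT (fun x => (mod2 (u x - h%:C%C * landau_expr B u x))%:E).
  by apply: (smoothC_integrable K _ cK sd) => x nKx; rewrite uK// KL// mulr0 subr0.
have := le_Rintegral measurableT id iuLD.
rewrite IuLD IuL ID.
have -> : (\int[vol R]_x 'D_(e1 R) (F w1) x = 0)%R by rewrite /Rintegral I1.
have -> : (\int[vol R]_x 'D_(e2 R) (F w2) x = 0)%R by rewrite /Rintegral I2.
rewrite mulr0 addr0 mulr0 addr0; apply => x _.
by rewrite mul1r; exact: ptw.
Qed.

Lemma test_function_smooth {R : realType} (u : R * R -> R[i]) :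
  test_function u -> exists K : set (R * R),
  [/\ compact K, smoothC u & forall x, ~ K x -> u x = 0].
Proof.
move=> [ru iu cK]; exists (closure [set x | u x != 0]); split => // x nKx.
by apply/eqP/negP => /negP ux; apply: nKx; exact: subset_closure.
Qed.

Lemma landau_expr_smooth {R : realType} (B : R) (K : set (R * R)) (u : R * R -> R[i]) :
  closed K -> smoothC u -> (forall x, ~ K x -> u x = 0) ->
  smoothC (landau_expr B u) /\ (forall x, ~ K x -> landau_expr B u x = 0).
Proof.
move=> KC su uK.
have s1 := smoothC_magnetic1 B _ su; have s2 := smoothC_magnetic2 B _ su.
have K1 x (nKx : ~ K x) := (magnetic_outside B K u KC uK x nKx).1.
have K2 x (nKx : ~ K x) := (magnetic_outside B K u KC uK x nKx).2.
split; first by apply: smoothCD; [exact: smoothC_magnetic1|exact: smoothC_magnetic2].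
move=> x nKx; rewrite /landau_expr (magnetic_outside B K _ KC K1 x nKx).1.
by rewrite (magnetic_outside B K _ KC K2 x nKx).2 addr0.
Qed.

(** The constant [c] may depend on [d], as the factor 1 + 1/d in Young's inequality does. So [e]
    tends to 0 first, with [d] fixed, and [d] afterwards. *)
Lemma le_of_perturbation {R : realType} (X A : R) : 0 <= A ->
  (forall d : R, 0 < d -> exists c : R, forall e, 0 < e -> X <= (1 + d) ^+ 2 * A + c * e) ->
  X <= A.
Proof.
move=> A0 H.
have H2 d : 0 < d -> X <= (1 + d) ^+ 2 * A.
  move=> d0; have [c Hc] := H _ d0; apply/ler_addgt0Pr => e e0.
  have c0 : 0 < `|c| + 1 by rewrite ltr_wpDl.
  apply: (le_trans (Hc (e / (`|c| + 1)) _)); first by rewrite divr_gt0.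
  rewrite lerD2l mulrA ler_pdivrMr// mulrC ler_pM2l//.
  by rewrite (le_trans (ler_norm _))// lerDl.
apply/ler_addgt0Pr => e e0.
(* For d <= 1 one has (1 + d)^2 <= 1 + 3 d, whence the factor 3; [A + 1] replaces [A] to be
   positive. *)
have d0 : 0 < Num.min 1 (e / (3 * (A + 1))).
  by rewrite lt_min ltr01 divr_gt0// mulr_gt0// ltr_wpDl.
set d := Num.min 1 _ in d0; have d1 : d <= 1 by rewrite ge_min lexx.
have dA : d * (3 * (A + 1)) <= e.
  by rewrite -ler_pdivlMr ?ge_min ?lexx ?orbT// mulr_gt0// ltr_wpDl.
apply: (le_trans (H2 _ d0)).
have : d * d * A <= d * A by rewrite -mulrA ler_piMl// mulr_ge0// ltW.
by nra.
Qed.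

Lemma cvg_sqnorm_near {R : realType} T (F : set_system T) (FF : Filter F)
    (g : T -> \bar R) (e : R) : 0 < e -> g x @[x --> F] --> 0%E ->
  \forall x \near F, (g x <= e%:E)%E.
Proof.
move=> e0 cg; have : nbhs (0%E : \bar R) [set y | (y < e%:E)%E].
  by apply: open_nbhs_nbhs; split; [exact: open_ereal_lt_ereal|rewrite /= lte_fin].
move=> n0; have h : F [set x | (g x < e%:E)%E] := cg _ n0.
by apply: (@filterS _ _ FF _ _ _ h) => x; exact: ltW.
Qed.

(** The inequality is transferred from an approximating test function. Young's inequality is used
    twice in succession, to compare [phi n] with [v] and its image with [f], then to compare the two
    left-hand sides; this yields the factor (1 + d)^2. *)
Lemma accretive_landau {R : realType} (B h : R) (v f : R * R -> R[i]) :
  0 <= h -> landau_op B v f ->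
  l2norm2 (fun x => v x - h%:C%C * f x) <= l2norm2 v + h ^+ 2 * l2norm2 f.
Proof.
move=> h0 [lv lf [phi [tphi cv cf]]].
apply: le_of_perturbation; first by rewrite addr_ge0 ?mulr_ge0 ?l2norm2_ge0 ?sqr_ge0.
(* The first summand collects the errors on the norms of [phi n] and of its image, the second the
   error [b] on the left-hand side. *)
move=> d d0; exists ((1 + d) * (1 + d^-1) * (1 + h ^+ 2) + (1 + d^-1) * (2 + 2 * h ^+ 2)) => e e0.
have [n [n1 n2]] : exists n, (sqnorm setT (fun x => phi n x - v x)%R <= e%:E)%E /\
    (sqnorm setT (fun x => landau_expr B (phi n) x - f x)%R <= e%:E)%E.
  have h1 := cvg_sqnorm_near _ _ eventually_filter _ _ e0 cv.
  have h2 := cvg_sqnorm_near _ _ eventually_filter _ _ e0 cf.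
  have [n [? ?]] := @filter_ex _ _ eventually_filter _ (filterI h1 h2).
  by exists n.
have [K [cK sp pK]] := test_function_smooth _ (tphi n).
have KC : closed K by apply: compact_closed => //; exact: norm_hausdorff.
have [sL LK] := landau_expr_smooth B _ _ KC sp pK.
have [lp _] := smoothC_integrable _ _ cK sp pK.
have [lL _] := smoothC_integrable _ _ cK sL LK.
have sub (f1 f2 : R * R -> R[i]) : (fun x => f1 x - f2 x) = (fun x => 1 * f1 x + (-1) * f2 x).
  by apply/funext => x; ring.
pose p1 x := phi n x - v x; pose p2 x := landau_expr B (phi n) x - f x.
have lp1 : sqintegrable p1 by rewrite /p1 sub; exact: sqintegrable_lin.
have lp2 : sqintegrable p2 by rewrite /p2 sub; exact: sqintegrable_lin.
have p1e : l2norm2 p1 <= e by move: n1; rewrite sqnormTE// lee_fin.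
have p2e : l2norm2 p2 <= e by move: n2; rewrite sqnormTE// lee_fin.
have mN1 : mod2 (-1 : R[i]) = 1 by rewrite mod2N (mod2_real 1) expr1n.
have m1 : mod2 (1 : R[i]) = 1 by rewrite (mod2_real 1) expr1n.
have hp : l2norm2 (phi n) <= (1 + d) * l2norm2 v + (1 + d^-1) * e.
  have := l2norm2_lin_le d 1 1 _ _ d0 lv lp1; rewrite m1 !mul1r.
  rewrite (_ : (fun x => _) = phi n); last by apply/funext => x; rewrite /p1; ring.
  by move=> /le_trans; apply; rewrite lerD2l ler_wpM2l// addr_ge0// invr_ge0 ltW.
have hL : l2norm2 (landau_expr B (phi n)) <= (1 + d) * l2norm2 f + (1 + d^-1) * e.
  have := l2norm2_lin_le d 1 1 _ _ d0 lf lp2; rewrite m1 !mul1r.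
  rewrite (_ : (fun x => _) = landau_expr B (phi n)); last by apply/funext => x; rewrite /p2; ring.
  by move=> /le_trans; apply; rewrite lerD2l ler_wpM2l// addr_ge0// invr_ge0 ltW.
have hA := accretive_smooth B h _ _ h0 cK sp pK.
pose a x := phi n x - h%:C%C * landau_expr B (phi n) x.
pose b x := 1 * p1 x + - h%:C%C * p2 x.
have la : sqintegrable a.
  rewrite /a (_ : (fun x => _) = fun x => 1 * phi n x + - h%:C%C * landau_expr B (phi n) x).
    exact: sqintegrable_lin.
  by apply/funext => x; ring.
have lb : sqintegrable b by exact: sqintegrable_lin.
have hb : l2norm2 b <= (2 + 2 * h ^+ 2) * e.
  have := l2norm2_lin_le 1 1 (- h%:C%C) _ _ ltr01 lp1 lp2; rewrite m1 mul1r mod2N mod2_real invr1.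
  move=> /le_trans; apply; rewrite [leRHS]mulrDl lerD//; first by rewrite ler_wpM2l.
  by rewrite -mulrA ler_wpM2l// ler_wpM2l// sqr_ge0.
have := l2norm2_lin_le d 1 (-1) _ _ d0 la lb; rewrite m1 mN1 !mul1r.
rewrite (_ : (fun x => _) = (fun x => v x - h%:C%C * f x)); last first.
  by apply/funext => x; rewrite /a /b /p1 /p2; ring.
move=> /le_trans; apply.
have d1 : 0 <= 1 + d by rewrite addr_ge0// ltW.
have d2 : 0 <= 1 + d^-1 by rewrite addr_ge0// invr_ge0 ltW.
have hA2 : l2norm2 a <= ((1 + d) * l2norm2 v + (1 + d^-1) * e) +
    h ^+ 2 * ((1 + d) * l2norm2 f + (1 + d^-1) * e).
  by rewrite (le_trans hA)// lerD// ler_wpM2l// sqr_ge0.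
apply: (le_trans (lerD (ler_wpM2l d1 hA2) (ler_wpM2l d2 hb))).
by rewrite le_eqVlt; apply/orP; left; apply/eqP; ring.
Qed.

(** * Test functions near the ground state *)

(* (p + i q) exp(i B/2 (a /\ x)).  The phase moves the centre of the magnetic
   potential from 0 to a. *)
Definition gauge {R : realType} (B : R) (a : R * R) (p q : R * R -> R)
    (x : R * R) : R[i] :=
  let t := B / 2 * (a.1 * x.2 - a.2 * x.1) in
  Complex (p x * cos t - q x * sin t) (p x * sin t + q x * cos t).

Lemma is_derive_gauge_phase {R : realType} (B : R) (a x v : R * R) :
  is_derive x v (fun y : R * R => B / 2 * (a.1 * y.2 - a.2 * y.1))
    (B / 2 * (a.1 * v.2 - a.2 * v.1)).
Proof.
have D1 := is_derive_fst x v; have D2 := is_derive_snd x v.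
exact: (is_deriveZ (B / 2) (is_deriveB (is_deriveZ a.1 D2) (is_deriveZ a.2 D1))).
Qed.

(** The product rule for (p + i q) exp(i t): the phase is kept and the amplitude becomes (dp + i dq)
    + i dt (p + i q). *)
Lemma derive_gauge {R : realType} (B : R) (a x v : R * R) (p q : R * R -> R)
    (dp dq : R) :
  is_derive x v p dp -> is_derive x v q dq ->
  let dt := B / 2 * (a.1 * v.2 - a.2 * v.1) in
  'D_v (fun y => complex.Re (gauge B a p q y)) x =
    complex.Re (gauge B a (fun=> dp - dt * q x) (fun=> dq + dt * p x) x) /\
  'D_v (fun y => complex.Im (gauge B a p q y)) x =
    complex.Im (gauge B a (fun=> dp - dt * q x) (fun=> dq + dt * p x) x).
Proof.
move=> Dp Dq dt.
have Dt := is_derive_gauge_phase B a x v.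
have Dc := is_derive_comp _ _ _ _ _ _ _ (is_derive_cos _) Dt.
have Ds := is_derive_comp _ _ _ _ _ _ _ (is_derive_sin _) Dt.
split.
- rewrite (@derive_val _ _ _ _ _ _ _ (is_deriveB (is_deriveM Dp Dc) (is_deriveM Dq Ds))).
  by rewrite /GRing.scale /gauge /= /dt; ring.
- rewrite (@derive_val _ _ _ _ _ _ _ (is_deriveD (is_deriveM Dp Ds) (is_deriveM Dq Dc))).
  by rewrite /GRing.scale /gauge /= /dt; ring.
Qed.

(** Along [e1] the phase has slope - B/2 a.2; the factor i of the magnetic derivative turns this
    into + B/2 a.2, which recentres the potential at [a]. All later estimates are uniform in [a] for
    this reason. *)
Lemma magnetic1_gauge {R : realType} (B : R) (a : R * R) (p q dp dq : R * R -> R) :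
  (forall x, is_derive x (e1 R) p (dp x)) -> (forall x, is_derive x (e1 R) q (dq x)) ->
  magnetic1 B (gauge B a p q) =
  gauge B a (fun x => - dq x - B / 2 * (x.2 - a.2) * p x)
            (fun x => dp x - B / 2 * (x.2 - a.2) * q x).
Proof.
move=> Dp Dq; apply/funext => x; have [Er Ei] := derive_gauge B a _ _ _ _ _ _ (Dp x) (Dq x).
apply/eqP; rewrite eq_complex Re_magnetic1 Im_magnetic1 Er Ei /gauge /=.
by apply/andP; split; apply/eqP; ring.
Qed.

Lemma magnetic2_gauge {R : realType} (B : R) (a : R * R) (p q dp dq : R * R -> R) :
  (forall x, is_derive x (e2 R) p (dp x)) -> (forall x, is_derive x (e2 R) q (dq x)) ->
  magnetic2 B (gauge B a p q) =
  gauge B a (fun x => - dq x + B / 2 * (x.1 - a.1) * p x)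
            (fun x => dp x + B / 2 * (x.1 - a.1) * q x).
Proof.
move=> Dp Dq; apply/funext => x; have [Er Ei] := derive_gauge B a _ _ _ _ _ _ (Dp x) (Dq x).
apply/eqP; rewrite eq_complex Re_magnetic2 Im_magnetic2 Er Ei /gauge /=.
by apply/andP; split; apply/eqP; ring.
Qed.

Definition dist2 {R : realType} (a x : R * R) : R :=
  (x.1 - a.1) ^+ 2 + (x.2 - a.2) ^+ 2.

Lemma is_derive_fstB {R : realType} (a x v : R * R) :
  is_derive x v (fun y : R * R => y.1 - a.1) v.1.
Proof.
have := is_deriveB (is_derive_fst x v) (is_derive_cst a.1 x v).
by rewrite subr0.
Qed.

Lemma is_derive_sndB {R : realType} (a x v : R * R) :
  is_derive x v (fun y : R * R => y.2 - a.2) v.2.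
Proof.
have := is_deriveB (is_derive_snd x v) (is_derive_cst a.2 x v).
by rewrite subr0.
Qed.

Lemma is_derive_radial {R : realType} (a x v : R * R) (k dk : R -> R) :
  (forall s : R, is_derive s 1 k (dk s)) ->
  is_derive x v (fun y => k (dist2 a y))
    (dk (dist2 a x) * (2 * ((x.1 - a.1) * v.1 + (x.2 - a.2) * v.2))).
Proof.
move=> Dk; apply: is_derive_comp.
have D1 := is_derive_fstB a x v; have D2 := is_derive_sndB a x v.
have := is_deriveD (is_deriveM D1 D1) (is_deriveM D2 D2).
rewrite (_ : _ + _ = dist2 a); last by apply/funext => y; rewrite /dist2 !expr2.
by move=> H; apply: (@is_derive_eq _ _ _ _ _ _ _ _ H); rewrite /GRing.scale /=; ring.
Qed.

(** With s = |x - a|^2, the planar Laplacian of k(s) is 4 k' + 4 s k'', and the squared potential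
    contributes B^2 s / 4. The first-order part of H_B is an angular derivative about [a] and kills
    radial functions. *)
Lemma landau_radial {R : realType} (B : R) (a : R * R) (k k1 k2 : R -> R) :
  (forall s : R, is_derive s 1 k (k1 s)) -> (forall s : R, is_derive s 1 k1 (k2 s)) ->
  landau_expr B (gauge B a (fun x => k (dist2 a x)) (fun=> 0)) =
  gauge B a (fun x => let s := dist2 a x in
    - 4 * k1 s - 4 * s * k2 s + B ^+ 2 / 4 * s * k s) (fun=> 0).
Proof.
move=> D1 D2.
have Dk x v := is_derive_radial a x v k k1 D1.
have Dk1 x v := is_derive_radial a x v k1 k2 D2.
have D0 (x v : R * R) := is_derive_cst (0 : R) x v.
have X1 x v := is_derive_fstB a x v.
have X2 x v := is_derive_sndB a x v.
rewrite /landau_expr.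
rewrite (magnetic1_gauge B a _ _ _ _ (fun x => Dk x _) (fun x => D0 x _)).
rewrite (magnetic2_gauge B a _ _ _ _ (fun x => Dk x _) (fun x => D0 x _)).
pose b : R := B / 2.
have bX2 x v : is_derive x v (fun y : R * R => b * (y.2 - a.2)) (b * v.2).
  exact: (is_deriveZ b (X2 x v)).
have bX1 x v : is_derive x v (fun y : R * R => b * (y.1 - a.1)) (b * v.1).
  exact: (is_deriveZ b (X1 x v)).
have tX1 x v : is_derive x v (fun y : R * R => 2 * (y.1 - a.1)) (2 * v.1).
  exact: (is_deriveZ (2 : R) (X1 x v)).
have tX2 x v : is_derive x v (fun y : R * R => 2 * (y.2 - a.2)) (2 * v.2).
  exact: (is_deriveZ (2 : R) (X2 x v)).
(* In these four facts the terms [- 0] and [* 0] are kept as the gauge lemmas produce them for q =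
   0, so that the second application can match them. *)
have P1 x : is_derive x (e1 R) (fun x => - 0 - B / 2 * (x.2 - a.2) * k (dist2 a x))
    (- (b * (x.2 - a.2) * (2 * (x.1 - a.1) * k1 (dist2 a x)))).
  have := is_deriveB (D0 x (e1 R)) (is_deriveM (bX2 x (e1 R)) (Dk x (e1 R))).
  rewrite (_ : _ - _ = (fun x => - 0 - B / 2 * (x.2 - a.2) * k (dist2 a x))); last first.
    by apply/funext => y; rewrite oppr0.
  move=> H; apply: (@is_derive_eq _ _ _ _ _ _ _ _ H).
  rewrite sub0r; congr (- _).
  by rewrite /GRing.scale /e1 /e2 /=; ring.
have P2 x : is_derive x (e2 R) (fun x => - 0 + B / 2 * (x.1 - a.1) * k (dist2 a x))
    (b * (x.1 - a.1) * (2 * (x.2 - a.2) * k1 (dist2 a x))).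
  have := is_deriveD (D0 x (e2 R)) (is_deriveM (bX1 x (e2 R)) (Dk x (e2 R))).
  rewrite (_ : _ + _ = (fun x => - 0 + B / 2 * (x.1 - a.1) * k (dist2 a x))); last first.
    by apply/funext => y; rewrite oppr0.
  by move=> H; apply: (@is_derive_eq _ _ _ _ _ _ _ _ H); rewrite /GRing.scale /e1 /e2 /=; ring.
have Q1 x : is_derive x (e1 R) (fun x => k1 (dist2 a x) *
    (2 * ((x.1 - a.1) * (e1 R).1 + (x.2 - a.2) * (e1 R).2)) - B / 2 * (x.2 - a.2) * 0)
    (k2 (dist2 a x) * (2 * (x.1 - a.1)) ^+ 2 + 2 * k1 (dist2 a x)).
  have := is_deriveM (Dk1 x (e1 R)) (tX1 x (e1 R)).
  rewrite (_ : (fun y => _) * _ = (fun x => k1 (dist2 a x) *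
    (2 * ((x.1 - a.1) * (e1 R).1 + (x.2 - a.2) * (e1 R).2)) - B / 2 * (x.2 - a.2) * 0)); last first.
    by apply/funext => y; rewrite !fctE /= /GRing.scale /=; ring.
  by move=> H; apply: (@is_derive_eq _ _ _ _ _ _ _ _ H); rewrite /GRing.scale /e1 /e2 /=; ring.
have Q2 x : is_derive x (e2 R) (fun x => k1 (dist2 a x) *
    (2 * ((x.1 - a.1) * (e2 R).1 + (x.2 - a.2) * (e2 R).2)) + B / 2 * (x.1 - a.1) * 0)
    (k2 (dist2 a x) * (2 * (x.2 - a.2)) ^+ 2 + 2 * k1 (dist2 a x)).
  have := is_deriveM (Dk1 x (e2 R)) (tX2 x (e2 R)).
  rewrite (_ : (fun y => _) * _ = (fun x => k1 (dist2 a x) *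
    (2 * ((x.1 - a.1) * (e2 R).1 + (x.2 - a.2) * (e2 R).2)) + B / 2 * (x.1 - a.1) * 0)); last first.
    by apply/funext => y; rewrite !fctE /= /GRing.scale /=; ring.
  by move=> H; apply: (@is_derive_eq _ _ _ _ _ _ _ _ H); rewrite /GRing.scale /e1 /e2 /=; ring.
rewrite (magnetic1_gauge B a _ _ _ _ P1 Q1) (magnetic2_gauge B a _ _ _ _ P2 Q2).
apply/funext => x; rewrite /gauge /= /b.
move: (cos _) (sin _) (k (dist2 a x)) (k1 (dist2 a x)) (k2 (dist2 a x)) => c s u u1 u2.
by rewrite /dist2; apply/eqP; rewrite eq_complex /=; apply/andP; split; apply/eqP; field.
Qed.

Lemma sqnorm_le_box {R : realType} (S Q : set (R * R)) (C : R)
    (u : R * R -> R[i]) :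
  lebesgue_measurable S -> lebesgue_measurable Q -> measurableC u -> 0 <= C ->
  (forall x, mod2 (u x) <= C) -> (forall x, ~ Q x -> u x = 0) ->
  (sqnorm S u <= C%:E * vol R (S `&` Q))%E.
Proof.
move=> mS mQ mu C0 uC uQ.
have mS' : measurable (S : set (lebplane R)) := mS.
have mQ' : measurable (Q : set (lebplane R)) := mQ.
have mSQ : measurable (S `&` Q : set (lebplane R)) := measurableI _ _ mS' mQ'.
have -> : sqnorm S u = (\int[vol R]_(x in S `&` Q) `|(mod2 (u x))%:E|)%E.
  rewrite integral_mkcondr; apply: eq_integral => x _.
  rewrite patchE; case: ifPn => [_|/negP xQ]; first by rewrite gee0_abs// lee_fin mod2_ge0.
  by rewrite uQ ?expr0n/= ?expr0n ?addr0// => /mem_set.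
have m : measurable_fun (S `&` Q : set (lebplane R)) (fun x => (mod2 (u x))%:E).
  by apply/measurable_EFinP; apply: measurable_funTS; exact: measurable_mod2.
apply: (@integral_le_bound _ _ _ (vol R) (S `&` Q) _ C%:E mSQ m).
  by rewrite lee_fin.
by apply: vol_aeW => x _; rewrite gee0_abs ?lee_fin ?mod2_ge0.
Qed.

Lemma sqnorm_ge_box {R : realType} (Q : set (R * R)) (c : R)
    (u : R * R -> R[i]) :
  lebesgue_measurable Q -> measurableC u -> 0 <= c ->
  (forall x, Q x -> c <= mod2 (u x)) ->
  (c%:E * vol R Q <= sqnorm setT u)%E.
Proof.
move=> mQ mu c0 uc.
have mQ' : measurable (Q : set (lebplane R)) := mQ.
have m : measurable_fun setT (fun x : lebplane R => (mod2 (u x))%:E).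
  by apply/measurable_EFinP; exact: measurable_mod2.
apply: (@le_trans _ _ (\int[vol R]_(x in Q) (mod2 (u x))%:E)%E).
  rewrite -(integral_cst (vol R) mQ' c%:E).
  apply: (ge0_le_integral (vol R) mQ').
  - by move=> x _; rewrite lee_fin.
  - exact: measurable_cst.
  - exact: (measurable_funTS m).
  - by move=> x Qx; rewrite lee_fin uc.
apply: (ge0_subset_integral (vol R) mQ' measurableT m) => // x _.
by rewrite lee_fin mod2_ge0.
Qed.

Lemma mod2_gauge {R : realType} (B : R) (a : R * R) (p q : R * R -> R) x :
  mod2 (gauge B a p q x) = p x ^+ 2 + q x ^+ 2.
Proof.
rewrite /mod2 /gauge /=; set t := B / 2 * _.
have := cos2Dsin2 t; move: (cos t) (sin t) => c s cs.
by rewrite -[RHS]mulr1 -cs; ring.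
Qed.

(** Differentiation of the bump family read on polynomials: [bump (bumpD p)] is the derivative of
    [bump p]. *)
Definition bumpD {R : realType} (p : {poly R}) : {poly R} := (p - p^`()) * 'X^2.

(** The radial profile of the trial function in the variable s = |x - a|^2, to be used with c = 1 /
    L^2: the mollifier exp(-1 / (1 - c s)), zero from c s = 1 on, times the Gaussian. [cutoff1] and
    [cutoff2] are its first two derivatives. *)
Definition cutoff {R : realType} (B c s : R) : R :=
  bump 1 (1 - c * s) * expR (- (B / 4 * s)).

Definition cutoff1 {R : realType} (B c s : R) : R :=
  (- c * bump (bumpD 1) (1 - c * s) - B / 4 * bump 1 (1 - c * s)) *
    expR (- (B / 4 * s)).

Definition cutoff2 {R : realType} (B c s : R) : R :=
  (c ^+ 2 * bump (bumpD (bumpD 1)) (1 - c * s)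
   + B / 2 * c * bump (bumpD 1) (1 - c * s)
   + B ^+ 2 / 16 * bump 1 (1 - c * s)) * expR (- (B / 4 * s)).

Lemma is_derive_bump_affine {R : realType} (p : {poly R}) (c s : R) :
  is_derive s 1 (fun t : R => bump p (1 - c * t)) (- c * bump (bumpD p) (1 - c * s)).
Proof.
have D : is_derive s 1 (fun t : R => 1 - c * t) (- c).
  have H := is_deriveB (is_derive_cst (1 : R) s 1) (is_deriveZ c (is_derive_id s 1)).
  by apply: (@is_derive_eq _ _ _ _ _ _ _ _ H); rewrite sub0r /GRing.scale /= mulr1.
rewrite [- c * _]mulrC.
exact: (is_derive1_comp (f := bump p) (g := fun t : R => 1 - c * t) (is_derive_bump p _) D).
Qed.

Lemma is_derive_expR_linear {R : realType} (b s : R) :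
  is_derive s 1 (fun t : R => expR (- (b * t))) (- b * expR (- (b * s))).
Proof.
have D : is_derive s 1 (fun t : R => - (b * t)) (- b).
  have H := is_deriveN (is_deriveZ b (is_derive_id s 1)).
  by apply: (@is_derive_eq _ _ _ _ _ _ _ _ H); rewrite /GRing.scale /= mulr1.
rewrite [- b * _]mulrC.
exact: (is_derive1_comp (f := @expR R) (g := fun t : R => - (b * t))).
Qed.

Lemma is_derive_cutoff {R : realType} (B c s : R) :
  is_derive s 1 (cutoff B c) (cutoff1 B c s).
Proof.
have H := is_deriveM (is_derive_bump_affine 1 c s) (is_derive_expR_linear (B / 4) s).
apply: (@is_derive_eq _ _ _ _ _ _ _ _ H).
by rewrite /cutoff1 /GRing.scale /=; ring.
Qed.

Lemma is_derive_cutoff1 {R : realType} (B c s : R) :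
  is_derive s 1 (cutoff1 B c) (cutoff2 B c s).
Proof.
have H1 : is_derive s 1
    (fun t : R => - c * bump (bumpD 1) (1 - c * t) - B / 4 * bump 1 (1 - c * t))
    (- c * (- c * bump (bumpD (bumpD 1)) (1 - c * s)) -
     B / 4 * (- c * bump (bumpD 1) (1 - c * s))).
  exact: (is_deriveB (is_deriveZ (- c) (is_derive_bump_affine (bumpD 1) c s))
    (is_deriveZ (B / 4) (is_derive_bump_affine 1 c s))).
have H := is_deriveM H1 (is_derive_expR_linear (B / 4) s).
apply: (@is_derive_eq _ _ _ _ _ _ _ _ H).
by rewrite /cutoff2 /GRing.scale /=; field.
Qed.

(** By [landau_radial] the left side is H_B - B on the profile. The terms with the undifferentiated
    bump cancel because the Gaussian has eigenvalue B; each remaining one differentiates the bump at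
    least once and so carries a factor [c]. *)
Lemma cutoff_defect {R : realType} (B c s : R) :
  - 4 * cutoff1 B c s - 4 * s * cutoff2 B c s + B ^+ 2 / 4 * s * cutoff B c s
    - B * cutoff B c s =
  c * (4 * bump (bumpD 1) (1 - c * s) - 4 * (c * s) * bump (bumpD (bumpD 1)) (1 - c * s)
       - 2 * (B * s) * bump (bumpD 1) (1 - c * s)) * expR (- (B / 4 * s)).
Proof. by rewrite /cutoff /cutoff1 /cutoff2; field. Qed.

(** Two factors grow with s. On the support of the bump c s < 1, and B s is absorbed by the Gaussian
    since y exp(-y) <= 1 for y = B s / 4. Hence [M] is independent of [c]. *)
Lemma cutoff_defect_le {R : realType} (B : R) : 0 <= B ->
  exists2 M, 0 < M & forall c s, 0 <= c -> 0 <= s ->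
  `|c * (4 * bump (bumpD 1) (1 - c * s) - 4 * (c * s) * bump (bumpD (bumpD 1)) (1 - c * s)
       - 2 * (B * s) * bump (bumpD 1) (1 - c * s)) * expR (- (B / 4 * s))| <= c * M.
Proof.
move=> B0; have [C1 C10 b1] := bump_bounded (bumpD (1 : {poly R})).
have [C2 C20 b2] := bump_bounded (bumpD (bumpD (1 : {poly R}))).
(* The three terms contribute 4 [C1], 4 [C2] and 8 [C1], the last because 2 B s = 8 y. *)
exists (12 * C1 + 4 * C2); first by rewrite addr_gt0// mulr_gt0.
move=> c s c0 s0; rewrite -mulrA normrM (ger0_norm c0) ler_wpM2l//.
have [cs|cs] := ltP 0 (1 - c * s); last first.
  by rewrite /bump ltNge cs/= !mulr0 !subr0 mul0r normr0 addr_ge0// mulr_ge0// ltW.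
have := b1 (1 - c * s); have := b2 (1 - c * s).
move: (bump (bumpD (bumpD 1)) _) (bump (bumpD 1) _) => f2 f1 hf2 hf1.
set y := B / 4 * s; have y0 : 0 <= y by rewrite mulr_ge0// divr_ge0.
have e0 := expR_ge0 (- y).
have e1 : expR (- y) <= 1 by rewrite expR_le1 oppr_le0.
have ye : y * expR (- y) <= 1.
  rewrite expRN ler_pdivrMr ?expR_gt0// mul1r.
  by rewrite (le_trans _ (expR_ge1Dx _))// lerDr.
have -> : B * s = 4 * y by rewrite /y; field.
have cs0 : 0 <= c * s by rewrite mulr_ge0.
have n1 : `|4 * f1 * expR (- y)| <= 4 * C1.
  rewrite !normrM (ger0_norm e0) normr_nat -[leRHS]mulr1.
  by rewrite ler_pM// ?mulr_ge0// ler_pM2l.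
have n2 : `|4 * (c * s) * f2 * expR (- y)| <= 4 * C2.
  rewrite -[X in `|X|](_ : 4 * f2 * (c * s * expR (- y)) = _); last by ring.
  rewrite normrM normrM normr_nat (ger0_norm (mulr_ge0 cs0 e0)) -[leRHS]mulr1.
  rewrite ler_pM// ?mulr_ge0// ?ler_pM2l// -[leRHS]mulr1 ler_pM//.
  by rewrite -subr_ge0 ltW.
have n3 : `|2 * (4 * y) * f1 * expR (- y)| <= 8 * C1.
  rewrite -[X in `|X|](_ : 8 * f1 * (y * expR (- y)) = _); last by ring.
  rewrite normrM normrM normr_nat (ger0_norm (mulr_ge0 y0 e0)) -[leRHS]mulr1.
  by rewrite ler_pM// ?mulr_ge0// ler_pM2l.
rewrite !mulrBl (le_trans (ler_normB _ _))//.
rewrite (le_trans (lerD (ler_normB _ _) (lexx _)))//.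
have -> : 12 * C1 + 4 * C2 = 4 * C1 + 4 * C2 + 8 * C1 by ring.
by rewrite !lerD.
Qed.

(* exp(-B |x - a|^2 / 4) is, up to the phase, an eigenfunction of H_B with
   eigenvalue B. *)
Definition trial {R : realType} (B L : R) (a : R * R) : R * R -> R[i] :=
  gauge B a (fun x => cutoff B (L ^- 2) (dist2 a x)) (fun=> 0).

Lemma dist2_ge0 {R : realType} (a x : R * R) : 0 <= dist2 a x.
Proof. by rewrite addr_ge0 ?sqr_ge0. Qed.

Lemma smoothC_trial {R : realType} (B L : R) (a : R * R) : smoothC (trial B L a).
Proof.
pose phase (x : R * R) := B / 2 * (a.1 * x.2 - a.2 * x.1).
have C n c : of_class_C n (fun _ : R * R => c) := of_class_C_cst n c.
have ct n : of_class_C n phase.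
  have := of_class_CM _ _ _ (C n (B / 2)) (of_class_C_lin n a.1 (- a.2) _ _ _
    (of_class_C_snd n) (of_class_C_fst n) (C n 1)).
  by congr of_class_C; apply/funext => x; rewrite /phase; ring.
have cd n : of_class_C n (dist2 a).
  have c1 := of_class_CD _ _ _ (of_class_C_fst n) (C n (- a.1)).
  have c2 := of_class_CD _ _ _ (of_class_C_snd n) (C n (- a.2)).
  have := of_class_CD _ _ _ (of_class_CM _ _ _ c1 c1) (of_class_CM _ _ _ c2 c2).
  by congr of_class_C; apply/funext => x; rewrite /dist2 !expr2.
have cw n : of_class_C n (fun x => cutoff B (L ^- 2) (dist2 a x)).
  have cb := of_class_C_bump n 1 _ (of_class_CD _ _ _ (C n 1)
    (of_class_CM _ _ _ (C n (- L ^- 2)) (cd n))).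
  have ce := of_class_C_expR n _ (of_class_CM _ _ _ (C n (- (B / 4))) (cd n)).
  have := of_class_CM _ _ _ cb ce.
  by congr of_class_C; apply/funext => x; rewrite /cutoff !mulNr.
split => n.
- have := of_class_CM _ _ _ (cw n) (of_class_C_trig n 1 0 _ (ct n)).
  by congr of_class_C; apply/funext => x; rewrite /= -/(phase x); ring.
- have := of_class_CM _ _ _ (cw n) (of_class_C_trig n 0 1 _ (ct n)).
  by congr of_class_C; apply/funext => x; rewrite /= -/(phase x); ring.
Qed.

(** Outside the square some coordinate is at distance more than L from the centre, so 1 - s / L^2 <=
    0 and the bump vanishes. The upper ends are written as lower end plus side to match the
    rectangles in [thick]. *)
Lemma trial_outside {R : realType} (B L : R) (a x : R * R) : 0 < L ->
  ~ (`[a.1 - L, a.1 - L + 2 * L] `*` `[a.2 - L, a.2 - L + 2 * L]) x ->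
  trial B L a x = 0.
Proof.
move=> L0 xQ; suff d : L ^+ 2 <= dist2 a x.
  rewrite /trial /gauge /cutoff /bump ltNge subr_le0 ler_pdivlMl ?exprn_gt0// mulr1 d /=.
  by rewrite !mul0r subrr addr0.
have far (t s : R) : ~ (s \in `[t - L, t - L + 2 * L]) -> L ^+ 2 <= (s - t) ^+ 2.
  move=> /negP; rewrite in_itv/= negb_and -!ltNge => /orP[h|h]; last by nra.
  by rewrite -sqrrN; nra.
have [x1|x1] := pselect (x.1 \in `[a.1 - L, a.1 - L + 2 * L]); last first.
  by rewrite (le_trans (far _ _ x1))// lerDl sqr_ge0.
have [x2|x2] := pselect (x.2 \in `[a.2 - L, a.2 - L + 2 * L]); last first.
  by rewrite (le_trans (far _ _ x2))// lerDr sqr_ge0.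
by case: xQ; split.
Qed.

Lemma cutoff_ge0 {R : realType} (B c s : R) : 0 <= cutoff B c s.
Proof.
rewrite mulr_ge0 ?expR_ge0// /bump hornerC mul1r.
by case: ifP => // _; exact: expR_ge0.
Qed.

Lemma cutoff_le1 {R : realType} (B c s : R) : 0 <= B -> 0 <= s ->
  cutoff B c s <= 1.
Proof.
move=> B0 s0; rewrite -[leRHS]mulr1 /cutoff /bump hornerC mul1r.
have e : expR (- (B / 4 * s)) <= 1.
  by rewrite expR_le1 oppr_le0 mulr_ge0// divr_ge0.
case: ifPn => [c0|_]; last by rewrite mul0r mulr1 ler01.
by rewrite ler_pM ?expR_ge0// expR_le1 oppr_le0 invr_ge0 ltW.
Qed.

(** The first factor is the value of the bump at 1/2; the second is a crude lower bound for the
    Gaussian on s <= 1. *)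
Lemma cutoff_ge {R : realType} (B c s : R) : 0 <= B -> 0 <= s <= 1 -> 0 <= c ->
  c * s <= 2^-1 -> expR (- 2) * expR (- B) <= cutoff B c s.
Proof.
move=> B0 /andP[s0 s1] c0 cs.
have h : 2^-1 <= 1 - c * s by rewrite lerBrDl -lerBrDr; apply: (le_trans cs); lra.
have h0 : 0 < 1 - c * s by apply: lt_le_trans h; rewrite invr_gt0.
rewrite /cutoff /bump h0 hornerC mul1r ler_pM ?expR_ge0// ler_expR lerN2.
  by rewrite -[leRHS]invrK lef_pV2// posrE invr_gt0.
by rewrite -[leRHS]mulr1 ler_pM// ?divr_ge0//; lra.
Qed.

Lemma test_function_trial {R : realType} (B L : R) (a : R * R) : 0 < L ->
  test_function (trial B L a).
Proof.
move=> L0; have [r i] := smoothC_trial B L a; split => //.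
pose Q : set (R * R) := `[a.1 - L, a.1 - L + 2 * L] `*` `[a.2 - L, a.2 - L + 2 * L].
have cQ : compact Q by apply: compact_setX; exact: segment_compact.
have Qc : closed Q by apply: compact_closed => //; exact: norm_hausdorff.
apply: (subclosed_compact _ cQ); first exact: closed_closure.
rewrite [X in _ `<=` X](iffLR (closure_id Q) Qc); apply: closure_subset => x /= /eqP ux.
by apply: contrapT => /(trial_outside _ _ _ _ L0).
Qed.

Lemma landau_trial {R : realType} (B L : R) (a x : R * R) :
  let c := L ^- 2 in let s := dist2 a x in
  mod2 (landau_expr B (trial B L a) x - B%:C%C * trial B L a x) =
  (c * (4 * bump (bumpD 1) (1 - c * s) - 4 * (c * s) * bump (bumpD (bumpD 1)) (1 - c * s)
       - 2 * (B * s) * bump (bumpD 1) (1 - c * s)) * expR (- (B / 4 * s))) ^+ 2.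
Proof.
move=> c s; rewrite -cutoff_defect /trial.
rewrite (landau_radial B a _ _ _ (is_derive_cutoff B c) (is_derive_cutoff1 B c)).
rewrite (_ : _ - _ = gauge B a (fun x => let s := dist2 a x in
    - 4 * cutoff1 B c s - 4 * s * cutoff2 B c s + B ^+ 2 / 4 * s * cutoff B c s
    - B * cutoff B c s) (fun=> 0) x); first by rewrite mod2_gauge expr0n addr0.
by apply/eqP; rewrite eq_complex /gauge /= -/s; apply/andP; split; apply/eqP; ring.
Qed.

Lemma trial_estimates {R : realType} (B : R) : 0 <= B ->
  exists M c : R, [/\ 0 < M, 0 < c & forall L (a : R * R), 1 <= L ->
    l2norm2 (fun x => landau_expr B (trial B L a) x - B%:C%C * trial B L a x) <= M / L ^+ 2 /\
    c <= l2norm2 (trial B L a)].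
Proof.
move=> B0; have [M M0 HM] := cutoff_defect_le B B0.
(* The defect is at most M / L^2 pointwise on a square of area 4 L^2, so its squared norm is at most
   4 M^2 / L^2. The lower bound comes from a square of side 1/2 about [a], of area 1/4, on which s
   <= 1/2. *)
exists (4 * M ^+ 2), ((expR (- 2) * expR (- B)) ^+ 2 / 4).
split; first by rewrite mulr_gt0// exprn_gt0.
  by rewrite divr_gt0// exprn_gt0// mulr_gt0// expR_gt0.
move=> L a L1; have L0 : 0 < L by apply: lt_le_trans L1.
have su := smoothC_trial B L a.
pose Q : set (R * R) := `[a.1 - L, a.1 - L + 2 * L] `*` `[a.2 - L, a.2 - L + 2 * L].
have uQ x : ~ Q x -> trial B L a x = 0 by exact: trial_outside.
have cQ : compact Q by apply: compact_setX; exact: segment_compact.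
have Qc : closed Q by apply: compact_closed => //; exact: norm_hausdorff.
have [sL LQ] := landau_expr_smooth B Q _ Qc su uQ.
have [lu _] := smoothC_integrable _ _ cQ su uQ.
have [lL _] := smoothC_integrable _ _ cQ sL LQ.
have mQ p q l : lebesgue_measurable (`[p, p + l] `*` `[q, q + l] : set (R * R)).
  by apply: measurable_lebplane; apply: measurableX; exact: measurable_itv.
split.
- have lf : sqintegrable (fun x => landau_expr B (trial B L a) x - B%:C%C * trial B L a x).
    have := sqintegrable_lin 1 (- B%:C%C) _ _ lL lu.
    by rewrite (_ : (fun x => _) = fun x => landau_expr B (trial B L a) x - B%:C%C * trial B L a x)//;
      apply/funext => x; ring.
  rewrite -lee_fin -sqnormTE//.
  apply: (le_trans (sqnorm_le_box setT Q ((L ^- 2 * M) ^+ 2) _ _ _ _ _ _ _)).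
  + exact: (measurable_lebplane _ measurableT).
  + exact: mQ.
  + exact: sqintegrable_measurable.
  + exact: sqr_ge0.
  + move=> x; rewrite landau_trial -[leLHS]real_normK ?num_real// lerXn2r ?nnegrE//.
      by apply: mulr_ge0; [rewrite invr_ge0 exprn_ge0// ltW|exact: ltW].
    by apply: HM; rewrite ?dist2_ge0// invr_ge0 exprn_ge0// ltW.
  + by move=> x nQ; rewrite uQ// LQ// mulr0 subr0.
  + rewrite setTI /Q vol_rectangle; [|by rewrite mulr_ge0// ltW|by rewrite mulr_ge0// ltW].
    by rewrite -EFinM lee_fin le_eqVlt; apply/orP; left; apply/eqP; field; rewrite gt_eqF.
- pose b : R := 2^-1; have b0 : 0 <= b by rewrite invr_ge0.
  rewrite -lee_fin -sqnormTE//.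
  apply: le_trans (sqnorm_ge_box (`[a.1 - b / 2, a.1 - b / 2 + b] `*` `[a.2 - b / 2, a.2 - b / 2 + b])
    ((expR (- 2) * expR (- B)) ^+ 2) _ _ _ _ _).
  + rewrite vol_rectangle// -EFinM lee_fin ler_wpM2l ?sqr_ge0// /b; lra.
  + exact: mQ.
  + exact: sqintegrable_measurable.
  + exact: sqr_ge0.
  + move=> x [/=]; rewrite !in_itv/= => /andP[x1 x2] /andP[x3 x4].
    have e0 : 0 <= expR (- 2) * expR (- B) by rewrite mulr_ge0// expR_ge0.
    rewrite mod2_gauge expr0n addr0 lerXn2r ?nnegrE ?cutoff_ge0//.
    have b4 : b / 2 = 4^-1 by rewrite /b; field.
    have d0 := dist2_ge0 a x.
    have d1 : dist2 a x <= 2^-1.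
      have h1 : (x.1 - a.1) ^+ 2 <= 4^-1 by rewrite /b in x1 x2 *; nra.
      have h2 : (x.2 - a.2) ^+ 2 <= 4^-1 by rewrite /b in x3 x4 *; nra.
      by rewrite /dist2; lra.
    have L2 : L ^- 2 <= 1 by rewrite invf_le1 ?exprn_gt0// exprn_ege1.
    apply: cutoff_ge => //; first by rewrite d0/=; lra.
      by rewrite invr_ge0 exprn_ge0// ltW.
    by apply: le_trans d1; rewrite ler_piMl.
Qed.

(** * Semigroups and the energy estimate *)

(** The integral of a nonnegative function is a supremum over simple functions below it, and each of
    these lies below the constant. No measurability of [f] enters, which suits the time integral of
    the norm of [U t u] on S. *)
Lemma ge0_le_integral_cst {d} {T : measurableType d} {R : realType}
    (mu : {measure set T -> \bar R}) (D : set T) (f : T -> \bar R) (c : \bar R) :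
  measurable D -> (forall x, D x -> (0 <= f x <= c)%E) ->
  (\int[mu]_(x in D) f x <= c * mu D)%E.
Proof.
move=> mD fc; have [->|/set0P[x0 Dx0]] := eqVneq D set0.
  by rewrite integral_set0 measure0 mule0.
have c0 : (0 <= c)%E by have /andP[/le_trans + fc0] := fc _ Dx0; apply.
rewrite -integral_cst// !ge0_integralE//; last by move=> x /fc /andP[].
apply: ereal_sup_le => _ [h /= hf <-]; exists h => // x.
apply: (le_trans (hf x)); rewrite !patchE; case: ifPn => // /set_mem Dx.
by have /andP[] := fc _ Dx.
Qed.

(* E t = K (exp t - 1) solves E' = E + K, E 0 = 0. *)
Lemma gronwall {R : realType} (G : R -> R) (K : R) : 0 <= K -> G 0 <= 0 ->
  (forall t A, 0 < t -> 0 <= A -> (forall s, 0 <= s < t -> G s <= A) -> G t <= A) ->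
  (forall t, 0 <= t -> exists2 d, 0 < d &
    forall h, 0 < h < d -> G (t + h) <= G t + h * (G t + K)) ->
  forall t, 0 <= t -> G t <= K * (expR t - 1).
Proof.
move=> K0 G0 Gl Gs; set E := fun t => K * (expR t - 1).
have E0 t : 0 <= t -> 0 <= E t.
  by move=> t0; rewrite mulr_ge0// subr_ge0 (le_trans _ (expR_ge1Dx _))// lerDl.
(* Since E t + K = K exp t, this is 1 + h <= exp h: E dominates its own Euler step. *)
have Eh t h : 0 <= t -> 0 <= h -> E t + h * (E t + K) <= E (t + h).
  move=> t0 h0; rewrite /E expRD.
  have := expR_ge1Dx h; have := expR_ge0 t; have := mulr_ge0 K0 (expR_ge0 t).
  by move: (expR t) (expR h) => a b Ka a0 hb; nra.
have Em s t : s <= t -> E s <= E t.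
  by move=> st; rewrite ler_wpM2l// lerB// ler_expR.
move=> t0 t00; rewrite leNgt; apply/negP => Gt0.
(* Continuity induction: the bound holds before the supremum [tau] of [A], reaches [tau] by the
   left-limit hypothesis, and is carried beyond it by the step hypothesis, a contradiction. *)
pose A := [set t | 0 <= t /\ forall s, 0 <= s <= t -> G s <= E s].
have A0 : A 0.
  split=> // s /andP[s1 s2]; have /eqP<- : 0 == s by rewrite eq_le s1 s2.
  by rewrite /E expR0 subrr mulr0.
have At0 : ubound A t0.
  move=> t [t1 At]; rewrite leNgt; apply/negP => tt0.
  by move: Gt0; rewrite ltNge At// t00 ltW.
have hs : has_sup A by split; [exists 0|exists t0].
set tau := sup A; have tau0 : 0 <= tau by apply: (ub_le_sup hs.2).
have Gtau_lt s : 0 <= s < tau -> G s <= E s.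
  move=> /andP[s0 st]; have ts : 0 < tau - s by rewrite subr_gt0.
  have [t [_ At] st'] := sup_adherent ts hs.
  by apply: At; rewrite s0/= ltW// (le_lt_trans _ st')// -/tau; lra.
have Gtau : G tau <= E tau.
  move: (tau0); rewrite le_eqVlt => /predU1P[<-|tau1].
    by rewrite (le_trans G0)// E0.
  apply: Gl => // [|s s1]; first exact: E0.
  by rewrite (le_trans (Gtau_lt _ s1))// Em// ltW//; case/andP: s1.
have [d d0 Gd] := Gs _ tau0.
have : A (tau + d / 2).
  split; first by rewrite addr_ge0// divr_ge0// ltW.
  move=> s /andP[s0 sd]; have [st|] := ltP s tau; first by rewrite Gtau_lt// s0.
  rewrite le_eqVlt => /predU1P[<-//|ts].
  have -> : s = tau + (s - tau) by ring.
  have h0 : 0 < s - tau by rewrite subr_gt0.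
  apply: le_trans (Eh _ _ tau0 (ltW h0)).
  apply: (le_trans (Gd _ _)); first by rewrite h0/=; lra.
  by apply: lerD => //; apply: ler_wpM2l; [exact: ltW|exact: lerD].
move=> Ad; have : tau + d / 2 <= tau by apply: (ub_le_sup hs.2).
by lra.
Qed.

Lemma cvg0_dominated {R : realType} T (F : set_system T) (FF : Filter F)
    (g g1 g2 : T -> \bar R) (a b : R) :
  (\forall x \near F, 0 <= g x <= a%:E * g1 x + b%:E * g2 x)%E ->
  g1 x @[x --> F] --> 0%E -> g2 x @[x --> F] --> 0%E -> g x @[x --> F] --> 0%E.
Proof.
move=> gab c1 c2.
have c : (a%:E * g1 x + b%:E * g2 x)%E @[x --> F] --> 0%E.
  have d1 : (a%:E * g1 x)%E @[x --> F] --> (a%:E * 0)%E by apply: cvgeZl.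
  have d2 : (b%:E * g2 x)%E @[x --> F] --> (b%:E * 0)%E by apply: cvgeZl.
  have := cvgeD _ d1 d2; rewrite !mule0 add0e; apply.
  by rewrite /adde_def.
by apply: (squeeze_cvge gab) => //; exact: cvg_cst.
Qed.

Section semigroup.
Context {R : realType} {H : (R * R -> R[i]) -> (R * R -> R[i]) -> Prop}
  {U : R -> (R * R -> R[i]) -> (R * R -> R[i])} (SU : exp_semigroup H U).

Lemma semigroup_sqintegrable t u : 0 <= t -> sqintegrable u -> sqintegrable (U t u).
Proof. by move: SU => [[+ _ _] _]; apply. Qed.

Lemma semigroup_lin t (a b : R[i]) u v : 0 <= t -> sqintegrable u -> sqintegrable v ->
  ae_equal (U t (fun x => a * u x + b * v x)) (fun x => a * U t u x + b * U t v x).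
Proof.
move: SU => [[_ lin _] _] t0 lu lv.
have lbv : sqintegrable (fun x => b * v x).
  have := sqintegrable_lin b 0 _ _ lv lv.
  by rewrite (_ : (fun x => _) = fun x => b * v x)//; apply/funext => x; rewrite mul0r addr0.
(* Linearity is given for a u + v only; b v = (b - 1) v + v yields homogeneity. *)
have := lin t (b - 1) v v t0 lv lv.
rewrite (_ : (fun x => _ + v x) = fun x => b * v x); last by apply/funext => x; ring.
move=> h1; have h2 := lin t a u _ t0 lu lbv.
apply: (vol_aeS _ _ (vol_aeI _ _ h1 h2)) => x [e1 e2].
by rewrite e2 e1; ring.
Qed.

Lemma generator_sqintegrable u f : H u f -> sqintegrable u /\ sqintegrable f.
Proof. by move: SU => [_ [_ _ _ gen]] /gen[]. Qed.

Let quotient h (u f : R * R -> R[i]) (x : R * R) : R[i] :=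
  h^-1%:C%C * (u x - U h u x) - f x.

Lemma sqintegrable_quotient h u f : 0 <= h -> sqintegrable u -> sqintegrable f ->
  sqintegrable (quotient h u f).
Proof.
move=> h0 lu lf.
have l1 := sqintegrable_lin (h^-1%:C%C) (- h^-1%:C%C) _ _ lu (semigroup_sqintegrable _ _ h0 lu).
have := sqintegrable_lin 1 (-1) _ _ l1 lf.
by rewrite (_ : (fun x => _) = quotient h u f)//; apply/funext => x; rewrite /quotient; ring.
Qed.

Lemma generator_lin (a b : R[i]) u f v g : H u f -> H v g ->
  H (fun x => a * u x + b * v x) (fun x => a * f x + b * g x).
Proof.
move: (SU) => [_ [_ _ _ gen]] /gen[lu lf cu] /gen[lv lg cv].
apply/gen; split; [exact: sqintegrable_lin|exact: sqintegrable_lin|].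
apply: (cvg0_dominated _ _ _ _ _ _ (2 * mod2 a) (2 * mod2 b) _ cu cv).
near=> h; rewrite sqnorm_ge0/=.
have h0 : 0 <= h by apply: ltW; near: h; exact: nbhs_right_gt.
apply: sqnorm_dominated.
- exact: (measurable_lebplane _ measurableT).
- by rewrite mulr_ge0// mod2_ge0.
- by rewrite mulr_ge0// mod2_ge0.
- apply: sqintegrable_measurable.
  by apply: (sqintegrable_quotient h _ _ h0); exact: sqintegrable_lin.
- by apply: sqintegrable_measurable; exact: (sqintegrable_quotient h _ _ h0).
- by apply: sqintegrable_measurable; exact: (sqintegrable_quotient h _ _ h0).
- apply: (vol_aeS _ _ (semigroup_lin h a b _ _ h0 lu lv)) => x ->.
  rewrite -[X in mod2 X](_ : a * quotient h u f x + b * quotient h v g x = _); last first.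
    by rewrite /quotient; ring.
  by apply: (le_trans (mod2D_le 1 _ _ ltr01)); rewrite !mod2M invr1 !mulrA.
Unshelve. all: by end_near. Qed.

(** Almost everywhere, the difference quotient of [U t u] is [U t] applied to that of [u], and [U t]
    is bounded, so convergence to 0 is inherited. *)
Lemma generator_commutes t u f : 0 <= t -> H u f -> H (U t u) (U t f).
Proof.
move=> t0; move: (SU) => [[_ _ bdd] [_ sg _ gen]] /gen[lu lf cu].
apply/gen; split; [exact: semigroup_sqintegrable|exact: semigroup_sqintegrable|].
have [M HM] := bdd t t0.
apply: (cvg0_dominated _ _ _ _ _ _ (2 * M) 0 _ cu cu).
near=> h; rewrite sqnorm_ge0/=.
have h0 : 0 <= h by apply: ltW; near: h; exact: nbhs_right_gt.
have lq := sqintegrable_quotient h _ _ h0 lu lf.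
have lUq := semigroup_sqintegrable _ _ t0 lq.
have lUh := semigroup_sqintegrable _ _ h0 lu.
have hM := HM _ lq.
apply: (@le_trans _ _ (2%:E * sqnorm setT (U t (quotient h u f)))%E); last first.
  rewrite EFinM -muleA mul0e adde0 lee_pmul2l//.
have lw : sqintegrable (quotient h (U t u) (U t f)).
  by apply: (sqintegrable_quotient h _ _ h0); exact: semigroup_sqintegrable.
have dom : {ae vol R, forall x, mod2 (quotient h (U t u) (U t f) x) <=
    2 * mod2 (U t (quotient h u f) x) + 0 * mod2 (U t (quotient h u f) x)}.
  have l1 := sqintegrable_lin (h^-1%:C%C) (- h^-1%:C%C) _ _ lu lUh.
  have e1 := semigroup_lin t 1 (-1) _ _ t0 l1 lf.
  have e2 := semigroup_lin t (h^-1%:C%C) (- h^-1%:C%C) _ _ t0 lu lUh.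
  (* Splitting t + h in both orders makes [U t] and [U h] commute on [u]. *)
  have e3 := sg t h u t0 h0 lu; have e4 := sg h t u h0 t0 lu.
  rewrite addrC in e4.
  have qE : (fun x => 1 * (h^-1%:C%C * u x + - h^-1%:C%C * U h u x) + -1 * f x) = quotient h u f.
    by apply/funext => x; rewrite /quotient; ring.
  rewrite qE in e1.
  apply: (vol_aeS _ _ (vol_aeI _ _ (vol_aeI _ _ e1 e2) (vol_aeI _ _ e3 e4))) => x [[-> ->] [e5 e6]].
  rewrite mul0r addr0 -e5 e6.
  rewrite (_ : 1 * _ + _ = quotient h (U t u) (U t f) x); last by rewrite /quotient; ring.
  by rewrite ler_peMl ?mod2_ge0// ler1n.
have := sqnorm_dominated _ _ _ _ _ _ (measurable_lebplane _ measurableT) (ler0n _ 2) (lexx 0)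
  (sqintegrable_measurable _ lw) (sqintegrable_measurable _ lUq) (sqintegrable_measurable _ lUq) dom.
by rewrite mul0e adde0.
Unshelve. all: by end_near. Qed.

End semigroup.

Lemma near_at_right0 {R : realType} (P : R -> Prop) :
  (\forall h \near 0^'+, P h) -> exists2 d : R, 0 < d & forall h, 0 < h < d -> P h.
Proof.
move=> /nbhs_ballP[d /= d0 dP]; exists d => // h /andP[h0 hd].
by apply: dP => //; rewrite /ball/= sub0r normrN gtr0_norm.
Qed.

(** Both bounds come from exp y >= 1 + y, taken at - x and at x; the second gives exp(-x) <= 1 / (1
    + x) = 1 - x + x^2 / (1 + x). *)
Lemma expRN_taylor {R : realType} (x : R) : 0 <= x ->
  0 <= expR (- x) - 1 + x <= x ^+ 2.
Proof.
move=> x0; have h := expR_ge1Dx (- x); apply/andP; split; first by lra.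
have x1 : 0 < 1 + x by rewrite ltr_wpDr.
have : expR (- x) <= (1 + x)^-1.
  by rewrite expRN lef_pV2 ?posrE ?expR_gt0// expR_ge1Dx.
have -> : (1 + x)^-1 = 1 - x + x ^+ 2 / (1 + x) by field; rewrite gt_eqF.
have : x ^+ 2 / (1 + x) <= x ^+ 2.
  by rewrite ler_pdivrMr// ler_peMr ?sqr_ge0// lerDl.
by lra.
Qed.

(** How far the evolution of [u] is from that of an exact eigenfunction of eigenvalue B. *)
Definition deviation {R : realType} (B : R)
    (U : R -> (R * R -> R[i]) -> R * R -> R[i]) (u : R * R -> R[i]) (t : R)
    (x : R * R) : R[i] :=
  U t u x - (expR (- (B * t)))%:C%C * u x.

Lemma sqintegrable_deviation {R : realType} (B t : R) H U (u : R * R -> R[i]) :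
  exp_semigroup H U -> 0 <= t -> sqintegrable u -> sqintegrable (deviation B U u t).
Proof.
move=> SU t0 lu.
have := sqintegrable_lin 1 (- (expR (- (B * t)))%:C%C) _ _ (semigroup_sqintegrable SU t u t0 lu) lu.
by rewrite (_ : (fun x => _) = deviation B U u t)//; apply/funext => x; rewrite /deviation; ring.
Qed.

(** The bookkeeping of one Euler step: [G], [Y], [F], [Bb] are the squared norms of y, H_B y, the
    defect f and the forcing b. As (1 + 1/h) h^2 = h (1 + h), the forcing enters linearly in h, and
    all terms of higher order fit into 3 [n]. *)
Lemma energy_arith {R : realType} (h G Y Bb K F n W : R) :
  0 < h -> h <= 1 -> 0 <= G -> 0 <= Y -> 0 <= F -> 0 <= n -> 0 <= W ->
  K = 3 * F + 6 * n -> Bb <= 3 * F + 3 * n + 3 * (W * h) ->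
  h * (2 * Y + 6 * W + 3 * F + 3 * n) <= 3 * n ->
  (1 + h) * (G + h ^+ 2 * Y) + (1 + h^-1) * (h ^+ 2 * Bb) <= G + h * (G + K).
Proof.
move=> h0 h1 G0 Y0 F0 n0 W0 -> hB hC.
have -> : (1 + h^-1) * (h ^+ 2 * Bb) = h * ((1 + h) * Bb) by field; rewrite gt_eqF.
have hY : (1 + h) * (h * Y) <= 2 * (h * Y).
  have hY0 : 0 <= h * Y by rewrite mulr_ge0// ltW.
  by apply: ler_wpM2r => //; lra.
have hW : h * (W * h) <= W * h by rewrite ler_piMl// mulr_ge0// ltW.
have hBb : (1 + h) * Bb <= (1 + h) * (3 * F + 3 * n + 3 * (W * h)).
  by rewrite ler_wpM2l//; lra.
have key : (1 + h) * (h * Y) + (1 + h) * Bb <= 3 * F + 6 * n.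
  have e1 : (1 + h) * (3 * F + 3 * n + 3 * (W * h)) =
    3 * F + 3 * n + 3 * (W * h) + h * (3 * F + 3 * n) + 3 * (h * (W * h)) by ring.
  have e2 : h * (2 * Y + 6 * W + 3 * F + 3 * n) =
    2 * (h * Y) + 6 * (W * h) + h * (3 * F + 3 * n) by ring.
  apply: (le_trans (lerD hY hBb)); rewrite e1; move: hC hW; rewrite e2.
  move: (h * (3 * F + 3 * n)) => c; move: (h * (W * h)) => d.
  by move: (W * h) (h * Y) => *; lra.
have hk := ler_wpM2l (ltW h0) key.
rewrite [leLHS](_ : _ = G + h * G + h * ((1 + h) * (h * Y) + (1 + h) * Bb)); last by ring.
have -> : G + h * (G + (3 * F + 6 * n)) = G + h * G + h * (3 * F + 6 * n) by ring.
by rewrite lerD2l.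
Qed.

Section energy.
Context {R : realType} (B : R) (U : R -> (R * R -> R[i]) -> R * R -> R[i]).
Context (B0 : 0 <= B) (SU : exp_semigroup (landau_op B) U).
Context (u w : R * R -> R[i]) (Huw : landau_op B u w).

Let f (x : R * R) : R[i] := w x - B%:C%C * u x.
Let G t := l2norm2 (deviation B U u t).

(** Young's inequality with weight d = h splits y(t + h) into the free Euler step, controlled by
    accretivity, and the forcing. The strict inequality on [K] leaves the room for errors that
    vanish with h. *)
Lemma energy_step (K t : R) : 3 * l2norm2 f < K -> 0 <= t ->
  exists2 d, 0 < d & forall h, 0 < h < d -> G (t + h) <= G t + h * (G t + K).
Proof.
move=> fK t0; have [lu lw] := generator_sqintegrable SU _ _ Huw.
have lf : sqintegrable f.
  have := sqintegrable_lin 1 (- B%:C%C) _ _ lw lu.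
  by rewrite (_ : (fun x => _) = f)//; apply/funext => x; rewrite /f; ring.
pose c := expR (- (B * t)); pose v := U t u; pose g := U t w.
have c0 : 0 <= c by exact: expR_ge0.
have c1 : c <= 1 by rewrite expR_le1 oppr_le0 mulr_ge0.
have Hvg : landau_op B v g := generator_commutes SU _ _ _ t0 Huw.
have [lv lg] := generator_sqintegrable SU _ _ Hvg.
have Hy := generator_lin SU 1 (- c%:C%C) _ _ _ _ Hvg Huw.
have yE : (fun x => 1 * v x + - c%:C%C * u x) = deviation B U u t.
  by apply/funext => x; rewrite /deviation -/v -/c; ring.
rewrite yE in Hy; set Ly := (fun x => 1 * g x + - c%:C%C * w x) in Hy.
have [ly lLy] := generator_sqintegrable SU _ _ Hy.
(* So K = 3 |f|^2 + 6 n: one half of the slack pays for the error [r] of the difference quotient,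
   the other for the terms of higher order in h. *)
pose n := (K - 3 * l2norm2 f) / 6; have n0 : 0 < n by rewrite divr_gt0// subr_gt0.
pose r h (x : R * R) := h^-1%:C%C * (v x - U h v x) - g x.
have [d1 d10 rd] : exists2 d1, 0 < d1 & forall h, 0 < h < d1 -> (sqnorm setT (r h) <= n%:E)%E.
  apply: near_at_right0; apply: cvg_sqnorm_near => //.
  by move: SU => [_ [_ _ _ gen]]; have [_ _] := (gen _ _).1 Hvg.
pose W := B ^+ 4 * l2norm2 u.
have W0 : 0 <= W by rewrite mulr_ge0 ?l2norm2_ge0// exprn_ge0.
pose C := 2 * l2norm2 Ly + 6 * W + 3 * l2norm2 f + 3 * n.
have C0 : 0 < C + 1.
  have := l2norm2_ge0 Ly; have := l2norm2_ge0 f; rewrite /C; lra.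
exists (Num.min d1 (Num.min 1 (3 * n / (C + 1)))).
  by rewrite !lt_min d10 ltr01 divr_gt0// mulr_gt0.
move=> h /andP[h0]; rewrite !lt_min => /and3P[hd1 h1 hC].
have lr : sqintegrable (r h).
  have lUv := semigroup_sqintegrable SU _ _ (ltW h0) lv.
  have l1 := sqintegrable_lin (h^-1%:C%C) (- h^-1%:C%C) _ _ lv lUv.
  have := sqintegrable_lin 1 (-1) _ _ l1 lg.
  by rewrite (_ : (fun x => _) = r h)//; apply/funext => x; rewrite /r; ring.
have rn : l2norm2 (r h) <= n by rewrite -lee_fin -sqnormTE// rd// h0.
(* The scaled Taylor remainder: exp(- B h) = 1 - B h + h k with 0 <= k <= B^2 h. *)
pose k := h^-1 * (expR (- (B * h)) - 1 + B * h).
have k2 : (c * k) ^+ 2 <= B ^+ 4 * h.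
  have /andP[k0 kB] := expRN_taylor (B * h) (mulr_ge0 B0 (ltW h0)).
  have kk0 : 0 <= k by rewrite mulr_ge0// invr_ge0 ltW.
  have kk1 : k <= B ^+ 2 * h by rewrite /k ler_pdivrMl// (le_trans kB)// le_eqVlt;
    apply/orP; left; apply/eqP; ring.
  have ck : c * k <= B ^+ 2 * h by rewrite (le_trans _ kk1)// ler_piMl.
  apply: (@le_trans _ _ ((B ^+ 2 * h) ^+ 2)).
    have ck0 : 0 <= c * k by exact: mulr_ge0.
    by rewrite lerXn2r ?nnegrE// (le_trans ck0).
  rewrite exprMn -exprM ler_wpM2l ?exprn_ge0// expr2 ler_piMl// ltW//.
(* With y = deviation B U u t, whose image under H_B is Ly,
   y(t + h) = (y - h Ly) - h b, and |y - h Ly|^2 <= |y|^2 + h^2 |Ly|^2. *)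
pose rest x := 1 * r h x + (c * k)%:C%C * u x.
pose b x := c%:C%C * f x + 1 * rest x.
have lrest : sqintegrable rest by exact: sqintegrable_lin.
have lb : sqintegrable b by exact: sqintegrable_lin.
have b_le : l2norm2 b <= 3 * l2norm2 f + 3 * n + 3 * (W * h).
  have h2 := l2norm2_lin_le 1 1 (c * k)%:C%C _ _ ltr01 lr lu.
  (* Weight 2 here and weight 1 inside [rest] give 3 |f|^2 + (3/2) (2 n + 2 W h). *)
  have h3 := l2norm2_lin_le 2 c%:C%C 1 _ _ (ltr0n _ 2) lf lrest.
  rewrite mod2_1 mul1r mod2_real invr1 in h2; rewrite mod2_1 mul1r mod2_real in h3.
  have cf : c ^+ 2 * l2norm2 f <= l2norm2 f.
    by rewrite ler_piMl ?l2norm2_ge0// expr_le1.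
  have ku : (c * k) ^+ 2 * l2norm2 u <= W * h.
    have -> : W * h = B ^+ 4 * h * l2norm2 u by rewrite /W; ring.
    by rewrite ler_wpM2r// l2norm2_ge0.
  have e32 : 2^-1 = 1 / 2 :> R by rewrite div1r.
  apply: (le_trans h3); rewrite e32.
  move: h2; rewrite -/rest; move: (l2norm2 rest) (l2norm2 (r h)) rn => Rs rr rn h2.
  by lra.
pose z x := deviation B U u t x - h%:C%C * Ly x.
have lz : sqintegrable z.
  have := sqintegrable_lin 1 (- h%:C%C) _ _ ly lLy.
  by rewrite (_ : (fun x => _) = z)//; apply/funext => x; rewrite /z; ring.
have lth : 0 <= t + h by rewrite addr_ge0// ltW.
have -> : G (t + h) = l2norm2 (fun x => 1 * z x + - h%:C%C * b x).
  apply: l2norm2_ae; [exact: (sqintegrable_deviation _ _ _ _ _ SU)|exact: sqintegrable_lin|].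
  move: SU => [_ [_ sg _ _]].
  apply: (vol_aeS _ _ (sg h t u (ltW h0) t0 lu)) => x.
  rewrite addrC => Ux; rewrite /deviation Ux -/v.
  have -> : expR (- (B * (t + h))) = c * (1 - B * h + h * k).
    rewrite mulrDr opprD expRD -/c /k; congr (_ * _); field; by rewrite gt_eqF.
  rewrite /z /b /rest /f /r /Ly /deviation -/c -/v.
  have hh : h%:C%C * h^-1%:C%C = 1 :> R[i].
    by rewrite -rmorphM/= divff ?gt_eqF// ; congr (_ +i* _)%C.
  rewrite !rmorphM !rmorphD !rmorphN !rmorphM rmorph1.
  apply/eqP; rewrite -subr_eq0; apply/eqP.
  (* For [ring] the inverse of h is an independent symbol, so the difference of the two sides is
     exhibited as a multiple of h h^-1 - 1. *)
  transitivity ((h%:C%C * h^-1%:C%C - 1) * (v x - U h v x)); last by rewrite hh subrr mul0r.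
  by ring.
have hm : mod2 (- h%:C%C) = h ^+ 2 by rewrite mod2N mod2_real.
apply: (le_trans (l2norm2_lin_le h 1 (- h%:C%C) _ _ h0 lz lb)).
rewrite mod2_1 mul1r hm.
have acc := accretive_landau B h _ _ (ltW h0) Hy.
apply: (@le_trans _ _ ((1 + h) * (G t + h ^+ 2 * l2norm2 Ly) + (1 + h^-1) * (h ^+ 2 * l2norm2 b))).
  by rewrite lerD2r ler_wpM2l// addr_ge0// ltW.
apply: (energy_arith h _ _ _ K (l2norm2 f) n W) => //; try exact: l2norm2_ge0; try exact: ltW.
  by rewrite /n; field.
apply: (@le_trans _ _ (h * (C + 1))).
  by rewrite ler_wpM2l ?(ltW h0)// -/C lerDl.
by move: (ltW hC); rewrite ler_pdivlMr.
Qed.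

(** Strong continuity of the semigroup and continuity of exp(- B t) make y continuous from the left
    in L^2, so a bound on [0, t) extends to t. *)
Lemma energy_left (t A : R) : 0 < t -> 0 <= A ->
  (forall s, 0 <= s < t -> G s <= A) -> G t <= A.
Proof.
move=> t0 A0 GA; have [lu lw] := generator_sqintegrable SU _ _ Huw.
apply: le_of_perturbation => // d d0; exists ((1 + d^-1) * 4) => e e0.
have [d1 d10 Ud] : exists2 d1, 0 < d1 & forall s, 0 <= s -> `|t - s| < d1 ->
    (sqnorm setT (fun x => U s u x - U t u x)%R <= e%:E)%E.
  move: SU => [_ [_ _ cont _]].
  have FF : Filter (within [set s | 0 <= s] (nbhs t)) by exact: within_filter.
  have := cvg_sqnorm_near _ _ FF _ _ e0 (cont t u (ltW t0) lu).
  move=> /nbhs_ballP[d1 /= d10 P].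
  by exists d1 => // s s0 ts; apply: P.
pose q := B ^+ 2 * l2norm2 u + 1.
have q0 : 0 < q by rewrite ltr_wpDl// mulr_ge0 ?sqr_ge0 ?l2norm2_ge0.
(* The distance from s back to t: m <= t keeps s >= 0, m <= 1 gives m^2 <= m, d1 / 2 serves strong
   continuity, and e / q the change of the exponential. *)
pose m := Num.min (Num.min t 1) (Num.min (d1 / 2) (e / q)).
have m0 : 0 < m by rewrite !lt_min t0 ltr01 !divr_gt0.
have [mt m1 md mq] : [/\ m <= t, m <= 1, m <= d1 / 2 & m <= e / q].
  by split; rewrite !ge_min lexx ?orbT.
pose s := t - m; have s0 : 0 <= s by rewrite subr_ge0.
have st : s < t by rewrite ltrBlDr ltrDl.
have ts : t - s = m by rewrite /s; ring.
have tE : s + m = t by rewrite /s; ring.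
have Us := Ud s s0; rewrite ts gtr0_norm// in Us.
have {}Us := Us (le_lt_trans md _).
have {}Us : (sqnorm setT (fun x => U s u x - U t u x)%R <= e%:E)%E.
  by apply: Us; lra.
have lUs := semigroup_sqintegrable SU _ _ s0 lu.
have lUt := semigroup_sqintegrable SU _ _ (ltW t0) lu.
pose z1 x := U s u x - U t u x.
have lz1 : sqintegrable z1.
  have := sqintegrable_lin 1 (-1) _ _ lUs lUt.
  by rewrite (_ : (fun x => _) = z1)//; apply/funext => x; rewrite /z1; ring.
pose k := expR (- (B * s)) - expR (- (B * t)).
have k2 : k ^+ 2 * l2norm2 u <= e.
  have es0 := expR_ge0 (- (B * s)).
  have es1 : expR (- (B * s)) <= 1 by rewrite expR_le1 oppr_le0 mulr_ge0.
  have kE : k = expR (- (B * s)) * (1 - expR (- (B * m))).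
    have Et : expR (- (B * t)) = expR (- (B * s)) * expR (- (B * m)).
      by rewrite -expRD; congr expR; rewrite /s; ring.
    by rewrite /k Et; ring.
  have Bm : 0 <= B * m by rewrite mulr_ge0// ltW.
  have e1 : 0 <= 1 - expR (- (B * m)) by rewrite subr_ge0 expR_le1 oppr_le0.
  have e2 : 1 - expR (- (B * m)) <= B * m by have := expR_ge1Dx (- (B * m)); lra.
  have k0 : 0 <= k by rewrite kE mulr_ge0.
  have k1 : k <= B * m by rewrite kE (le_trans _ e2)// ler_piMl.
  apply: (@le_trans _ _ ((B * m) ^+ 2 * l2norm2 u)).
    by rewrite ler_wpM2r ?l2norm2_ge0// lerXn2r ?nnegrE.
  apply: (@le_trans _ _ (m * q)); last by rewrite -ler_pdivlMr.
  rewrite exprMn mulrAC mulrC /q.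
  have X0 : 0 <= B ^+ 2 * l2norm2 u by rewrite mulr_ge0 ?sqr_ge0 ?l2norm2_ge0.
  have mm : m ^+ 2 <= m by rewrite expr2 ler_piMl// ltW.
  apply: (le_trans (ler_wpM2r X0 mm)); rewrite ler_wpM2l ?lerDl// ltW//.
pose z x := 1 * z1 x + - k%:C%C * u x.
have lz : sqintegrable z by exact: sqintegrable_lin.
have z4 : l2norm2 z <= 4 * e.
  apply: (le_trans (l2norm2_lin_le 1 1 (- k%:C%C) _ _ ltr01 lz1 lu)).
  rewrite mod2_1 mul1r mod2N mod2_real invr1.
  have : l2norm2 z1 <= e by rewrite -lee_fin -sqnormTE.
  by lra.
have ls := sqintegrable_deviation B _ _ _ _ SU s0 lu.
have -> : G t = l2norm2 (fun x => 1 * deviation B U u s x + (-1) * z x).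
  congr l2norm2; apply/funext => x; rewrite /z /z1 /deviation /k rmorphB/=; ring.
apply: (le_trans (l2norm2_lin_le d 1 (-1) _ _ d0 ls lz)).
rewrite mod2N mod2_1 !mul1r lerD//.
  rewrite expr2 -mulrA; apply: ler_wpM2l; first by rewrite addr_ge0// ltW.
  apply: (le_trans (GA s _)); first by rewrite s0.
  by rewrite mulrDl mul1r lerDl mulr_ge0// ltW.
by rewrite -mulrA ler_wpM2l// addr_ge0// invr_ge0 ltW.
Qed.

Lemma energy_bound (K t : R) : 3 * l2norm2 f < K -> 0 <= t ->
  l2norm2 (deviation B U u t) <= K * (expR t - 1).
Proof.
move=> fK; have [lu lw] := generator_sqintegrable SU _ _ Huw.
have K0 : 0 <= K by apply: ltW; apply: le_lt_trans fK; rewrite mulr_ge0// l2norm2_ge0.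
apply: (gronwall G K K0); last 2 first.
- by move=> s A s0 A0; exact: energy_left.
- by move=> s; exact: energy_step.
rewrite /G (_ : l2norm2 _ = l2norm2 (fun x => 0 * u x)).
  by rewrite l2norm2Z// /mod2 /= expr0n addr0 mul0r.
apply: l2norm2_ae; first exact: (sqintegrable_deviation _ _ _ _ _ SU).
  have := sqintegrable_lin 0 0 _ _ lu lu.
  by rewrite (_ : (fun x => _) = (fun x => 0 * u x))//; apply/funext => x; rewrite mul0r addr0.
move: SU => [_ [U0 _ _ _]]; apply: (vol_aeS _ _ (U0 u lu)) => x.
by rewrite /deviation mulr0 oppr0 expR0 => ->; rewrite mul1r subrr mul0r.
Qed.

End energy.

(** * From observability to thickness *)

Lemma sqnorm_le_setT {R : realType} (S : set (R * R)) (u : R * R -> R[i]) :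
  lebesgue_measurable S -> measurableC u -> (sqnorm S u <= sqnorm setT u)%E.
Proof.
move=> mS mu; have mS' : measurable (S : set (lebplane R)) := mS.
have m : measurable_fun setT (fun x : lebplane R => (mod2 (u x))%:E).
  by apply/measurable_EFinP; exact: measurable_mod2.
apply: (ge0_subset_integral (vol R) mS' measurableT m _ (@subsetT _ _)) => x _.
by rewrite lee_fin mod2_ge0.
Qed.

Lemma landau_op_test_function {R : realType} (B : R) (u : R * R -> R[i]) :
  test_function u -> landau_op B u (landau_expr B u).
Proof.
move=> tu; have [K [cK su uK]] := test_function_smooth _ tu.
have KC : closed K by apply: compact_closed => //; exact: norm_hausdorff.
have [sL LK] := landau_expr_smooth B _ _ KC su uK.
have z (v : R * R -> R[i]) : sqnorm setT (fun x => v x - v x) = 0%E.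
  rewrite /sqnorm; under eq_integral do rewrite subrr /= expr0n addr0.
  exact: integral0.
split; [exact: (smoothC_integrable _ _ cK su uK).1|exact: (smoothC_integrable _ _ cK sL LK).1|].
by exists (fun=> u); split => //; rewrite z; exact: cvg_cst.
Qed.

(** The deviation terms add up to 2 K e (1 + 2 C^2 T), at most half of [al]. The other half must
    come from 4 C^2 T V, whence the factor 8. *)
Lemma observability_arith {R : realType} (al C T K e V : R) :
  0 < C -> 0 < T -> al <= 2 * (C ^+ 2 * ((2 * (K * e) + 2 * V) * T)) + 2 * (K * e) ->
  K * e * (1 + 2 * C ^+ 2 * T) <= al / 4 ->
  al / (8 * C ^+ 2 * T) <= V.
Proof.
move=> C0 T0 h1 h2.
have D0 : 0 < 8 * C ^+ 2 * T by rewrite !mulr_gt0// exprn_gt0.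
rewrite ler_pdivrMr//; move: h1 h2.
have -> : 2 * (C ^+ 2 * ((2 * (K * e) + 2 * V) * T)) + 2 * (K * e) =
  2 * (K * e * (1 + 2 * C ^+ 2 * T)) + (V * (8 * C ^+ 2 * T)) / 2 by field.
by move: (K * e * _) (V * _) => p q; lra.
Qed.

Theorem theorem23 (R : realType) (B T : R) (S : set (R * R))
    (U : R -> (R * R -> R[i]) -> (R * R -> R[i])) :
  0 <= B -> 0 < T -> lebesgue_measurable S ->
  exp_semigroup (landau_op B) U ->
  (exists Cobs : R, 0 < Cobs /\
    forall u0 : R * R -> R[i], sqintegrable u0 ->
      (sqnorm setT (U T u0) <=
       (Cobs ^+ 2)%:E *
         \int[lebesgue_measure]_(t in `[0%R, T]) sqnorm S (U t u0))%E) ->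
  thick S.
Proof.
move=> B0 T0 mS SU [C [C0 obs]].
have mS' : measurable (S : set (lebplane R)) := mS.
have [M [c [M0 c0 est]]] := trial_estimates B B0.
have eT0 : 0 <= expR T - 1.
  by rewrite subr_ge0 (le_trans _ (expR_ge1Dx _))// lerDl ltW.
(* A lower bound for the squared norm of exp(- B T) u, valid for all centres and all L >= 1. *)
pose al := expR (- (B * T)) ^+ 2 * c.
have al0 : 0 < al by rewrite mulr_gt0// exprn_gt0// expR_gt0.
pose D := 1 + 2 * C ^+ 2 * T.
have D0 : 0 <= D by rewrite addr_ge0// !mulr_ge0// ?sqr_ge0// ltW.
(* Chosen so that the squared deviation, at most 4 M / L^2 (exp T - 1), times [D] is at most al / 4;
   as L >= 1, L^2 is bounded below by L. *)
pose L := 1 + 16 * M * (expR T - 1) * D / al.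
have Z0 : 0 <= 16 * M * (expR T - 1) * D / al.
  by rewrite divr_ge0 ?(ltW al0)// !mulr_ge0// ltW.
have L1 : 1 <= L by rewrite lerDl.
have L0 : 0 < L by apply: lt_le_trans L1.
have LL0 : 0 < L ^+ 2 by rewrite exprn_gt0.
have LT : 4 * M / L ^+ 2 * (expR T - 1) * D <= al / 4.
  rewrite -(ler_pM2r LL0).
  have -> : 4 * M / L ^+ 2 * (expR T - 1) * D * L ^+ 2 =
      al / 4 * (16 * M * (expR T - 1) * D / al).
    by field; rewrite !gt_eqF.
  rewrite ler_wpM2l ?divr_ge0 ?(ltW al0)//.
  have : L <= L ^+ 2 by rewrite expr2 ler_peMl// ltW.
  by apply: le_trans; rewrite /L lerDr.
pose kap := al / (8 * C ^+ 2 * T).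
have kap0 : 0 < kap by rewrite divr_gt0// !mulr_gt0// exprn_gt0.
have L20 : 0 < 2 * L by rewrite mulr_gt0.
have L40 : 0 < 2 * L * (2 * L) by rewrite mulr_gt0.
(* The density is the volume bound [kap] over the area of the square, capped at 1 as [thick]
   demands. *)
exists (2 * L), (2 * L), (Num.min 1 (kap / (2 * L * (2 * L)))); split => //.
  by rewrite lt_min ltr01 divr_gt0//= ge_min lexx.
move=> a b /=; set Q : set (R * R) := `[a, a + 2 * L] `*` `[b, b + 2 * L].
pose p : R * R := (a + L, b + L); pose u := trial B L p.
have vQ : vol R Q = (2 * L * (2 * L))%:E by rewrite vol_rectangle// ltW.
have mQ : lebesgue_measurable Q.
  by apply: measurable_lebplane; apply: measurableX; exact: measurable_itv.
have mQ' : measurable (Q : set (lebplane R)) := mQ.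
have mSQ : measurable (S `&` Q : set (lebplane R)) := measurableI _ _ mS' mQ'.
have uQ x : ~ Q x -> u x = 0.
  by move=> nQ; apply: trial_outside => //; rewrite /p/= !addrK.
have tu : test_function u by exact: test_function_trial.
have Hu := landau_op_test_function B _ tu.
have [lu _] := generator_sqintegrable SU _ _ Hu.
have [fM cu] := est L p L1.
have Vfin : vol R (S `&` Q) \is a fin_num.
  rewrite ge0_fin_numE ?measure_ge0//.
  apply: (@le_lt_trans _ _ (vol R Q)); last by rewrite vQ ltry.
  by apply: le_measure; rewrite ?inE//; exact: subIsetr.
pose V := fine (vol R (S `&` Q)); have VE : vol R (S `&` Q) = V%:E by rewrite fineK.
have SV : (sqnorm S u <= V%:E)%E.
  have := sqnorm_le_box S Q 1 u mS mQ (sqintegrable_measurable _ lu) ler01 _ uQ.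
  rewrite VE mul1e; apply => x; rewrite mod2_gauge expr0n addr0.
  by rewrite expr_le1// ?cutoff_ge0// cutoff_le1// dist2_ge0.
(* The energy bound requires [K] strictly above 3 times the squared defect, which is at most M /
   L^2. *)
pose K := 4 * M / L ^+ 2.
have K0 : 0 <= K by rewrite divr_ge0// ?(ltW LL0)// mulr_ge0// ltW.
have fK : 3 * l2norm2 (fun x => landau_expr B u x - B%:C%C * u x) < K.
  have ML : 0 < M / L ^+ 2 by rewrite divr_gt0.
  by move: fM ML; rewrite /K -mulrA; move: (M / _) => m; lra.
have G_le t : 0 <= t <= T -> l2norm2 (deviation B U u t) <= K * (expR T - 1).
  move=> /andP[t0 tT]; apply: (le_trans (energy_bound B U B0 SU _ _ Hu K t fK t0)).
  by rewrite ler_wpM2l// lerB// ler_expR.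
have expB1 t : 0 <= t -> expR (- (B * t)) ^+ 2 <= 1.
  by move=> t0; rewrite expr_le1 ?expR_ge0// expR_le1 oppr_le0 mulr_ge0.
have US t : 0 <= t <= T -> (sqnorm S (U t u) <= (2 * (K * (expR T - 1)) + 2 * V)%:E)%E.
  move=> tT; have /andP[t0 _] := tT.
  have lUt := semigroup_sqintegrable SU _ _ t0 lu.
  have ld := sqintegrable_deviation B _ _ _ _ SU t0 lu.
  have md := sqintegrable_measurable _ ld.
  (* On S, [U t u] is y(t) plus a damped u: the first part is bounded by its norm on the whole
     plane, the second by the volume of S in the square. *)
  have dom : {ae vol R, forall x, mod2 (U t u x) <= 2 * mod2 (deviation B U u t x) + 2 * mod2 (u x)}.
    apply: vol_aeW => x.
    have := mod2D_le 1 (deviation B U u t x) ((expR (- (B * t)))%:C%C * u x) ltr01.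
    rewrite /deviation subrK invr1 mod2M mod2_real => /le_trans; apply.
    by rewrite lerD2l ler_wpM2l// ler_piMl ?mod2_ge0// expB1.
  apply: (le_trans (sqnorm_dominated S 2 2 _ _ _ mS (ler0n _ 2) (ler0n _ 2)
    (sqintegrable_measurable _ lUt) md (sqintegrable_measurable _ lu) dom)).
  rewrite [leRHS]EFinD; apply: leeD; rewrite [leRHS]EFinM; apply: lee_wpmul2l => //.
  apply: (le_trans (sqnorm_le_setT S _ mS md)).
  by rewrite sqnormTE// lee_fin G_le.
have I_le : (\int[lebesgue_measure]_(t in `[0%R, T]) sqnorm S (U t u) <=
    (2 * (K * (expR T - 1)) + 2 * V)%:E * T%:E)%E.
  have -> : T%:E = lebesgue_measure `[0%R, T]%classic.
    by rewrite lebesgue_measure_itv/= lte_fin T0 sube0.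
  apply: ge0_le_integral_cst; first exact: measurable_itv.
  by move=> t; rewrite /= in_itv/= => tT; rewrite sqnorm_ge0 US.
have lUT := semigroup_sqintegrable SU T u (ltW T0) lu.
have obs_le : l2norm2 (U T u) <= C ^+ 2 * ((2 * (K * (expR T - 1)) + 2 * V) * T).
  rewrite -lee_fin -sqnormTE// (le_trans (obs u lu))// !EFinM.
  by rewrite lee_wpmul2l// -EFinM lee_fin sqr_ge0.
(* Young's inequality with weight 1 for exp(- B T) u = U T u - y(T). *)
have al_le : al <= 2 * l2norm2 (U T u) + 2 * (K * (expR T - 1)).
  have ld := sqintegrable_deviation B _ _ _ _ SU (ltW T0) lu.
  have := l2norm2_lin_le 1 1 (-1) _ _ ltr01 lUT ld.
  rewrite (_ : (fun x => _) = fun x => (expR (- (B * T)))%:C%C * u x); last first.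
    by apply/funext => x; rewrite /deviation; ring.
  rewrite l2norm2Z// mod2_real mod2N mod2_1 !mul1r invr1.
  have : al <= expR (- (B * T)) ^+ 2 * l2norm2 u by rewrite ler_wpM2l// sqr_ge0.
  have := G_le T; rewrite ltW// lexx => /(_ isT).
  by move: (expR (- (B * T)) ^+ 2 * l2norm2 u) => q; lra.
have V_ge : kap <= V.
  apply: (observability_arith al C T K (expR T - 1) V C0 T0 _ LT).
  by rewrite (le_trans al_le)// lerD2r ler_wpM2l.
rewrite vQ VE -EFinM lee_fin (le_trans _ V_ge)//.
by rewrite -ler_pdivlMr// ge_min lexx orbT.
Qed.
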